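(* Let $X$ be a connected simple graph with countable vertex set, bounded degree and no vertex of degree one; let $M=\sup_{x\in VX}\deg(x)$, $\alpha=\frac{M+\sqrt{M^2+4M}}{2}$, $f(z)=A_Xz-Q_Xz^2$. For $x_0,x\in VX$ define $Z_X(u,x_0,x)=\exp\Big(\sum_{m=1}^\infty\frac{N_{X,m}(x_0,x)}{m}u^m\Big)$. Then for $|u|<1/\alpha$, $$Z_X(u,x_0,x)=(1-u^2)^{-\frac{\deg(x_0)-2}{2}\delta_{x_0}(x)}\times\exp\big(-[\log(I-(D_X-\Delta_X)u+(D_X-I)u^2)](x_0,x)\big)$$ $$\times\exp\Big(\int_0^u z^2\sum_{n=1}^\infty\frac1n\sum_{j=1}^{n-1}j\big[f(z)^{n-1-j}[A_X,D_X]f(z)^{j-1}\big](x_0,x)\,dz\Big)\times\exp\Big(\sum_{m=3}^\infty\frac{R_m(x_0,x)}{m}u^m\Big).$$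
   Context: A graph $X=(VX,EX)$ has maps $e\mapsto(o(e),t(e))$, $e\mapsto\bar e$ with $\bar e\ne e$, $\bar{\bar e}=e$, $o(e)=t(\bar e)$; simple means no loops and no multiple edges. $E_x=\{e:o(e)=x\}$, $\deg(x)=|E_x|$. A path $c=(e_1,\dots,e_n)$ ($t(e_i)=o(e_{i+1})$, $o(c)=o(e_1)$, $t(c)=t(e_n)$, length $n$; a vertex is a path of length 0) is geodesic if $e_{i+1}\ne\bar e_i$ for all $i$; a geodesic loop is a closed geodesic path. Operators on $\ell^2(VX)$: $(A_Xf)(x)=\sum_{e\in E_x}f(t(e))$, $(D_Xf)(x)=\deg(x)f(x)$, $\Delta_X=D_X-A_X$, $Q_X=D_X-I$, $[A_X,D_X]=A_XD_X-D_XA_X$; $(C_mf)(x)=\sum f(t(c))$ over geodesic paths $c$ of length $m$ with $o(c)=x$. $B_m=C_m$ for $m\le2$, $B_m=C_m-(Q_X-I)\sum_{j=1}^{\lfloor m/2\rfloor}C_{m-2j}$ for $m\ge3$. With $c_k(x)$ the number of geodesic loops of length $k$ at $x$ and $(\Delta_Xc_k)(x)=\deg(x)c_k(x)-\sum_{e\in E_x}c_k(t(e))$: $R_m=0$ for $m\le2$ and for $m\ge3$ $R_m$ is multiplication by $x\mapsto\sum_{j=1}^{\lceil m/2\rceil-1}j(\Delta_Xc_{m-2j})(x)$; $R_m^+=0$ for $m\le2$, $R_m^+=(Q_X-I)\delta_{2\mathbb Z}(m)+R_m$ for $m\ge3$ ($\delta_{2\mathbb Z}(m)=1$ if $m$ even,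 else $0$); $N_{X,m}=B_m+R_m^+$. For a bounded operator $B$, $B(x_0,x)=(B\delta_{x_0})(x)$ where $\delta_{x_0}$ is the indicator of $x_0$. $\log(I-g)=-\sum_{n\ge1}g^n/n$ for $\|g\|<1$ (here $g=f(u)$, which has norm $<1$ for $|u|<1/\alpha$). *)

(* Defs.v *)
From Stdlib Require Import Reals Lra List.
From Coquelicot Require Import Coquelicot.
Import ListNotations.
Open Scope R_scope.



(* Sum of a complex series (real and imaginary parts summed separately;
   it is the usual sum whenever the series converges). *)
Definition CSeries (a : nat -> C) : C :=
  (Series (fun n => Re (a n)), Series (fun n => Im (a n))).

Definition Cex_series (a : nat -> C) : Prop :=
  @ex_series C_AbsRing C_NormedModule a.

Definition Cexp (z : C) : C :=
  (exp (Re z) * cos (Im z), exp (Re z) * sin (Im z)).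

(* principal argument in (-PI, PI] *)
Definition Carg (w : C) : R :=
  if Rlt_dec 0 (Re w) then atan (Im w / Re w)
  else if Rlt_dec (Re w) 0 then
    (if Rle_dec 0 (Im w) then atan (Im w / Re w) + PI
     else atan (Im w / Re w) - PI)
  else (if Rlt_dec 0 (Im w) then PI / 2
        else if Rlt_dec (Im w) 0 then - (PI / 2) else 0).

Definition Clog (w : C) : C := (ln (Cmod w), Carg w).

Definition Cpowc (w s : C) : C := Cexp (s * Clog w).

(* complex line integral along the segment [0,u]:
   int_0^u h(z) dz = int_0^1 h(t u) u dt *)
Definition Cint_0 (h : C -> C) (u : C) : C :=
  RInt (V := C_R_CompleteNormedModule) (fun t : R => (h (RtoC t * u) * u)%C) 0 1.

(* A simple graph on a vertex type V with decidable equality, given by the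
   (finite) list of neighbours of each vertex.  The oriented edges e with
   o(e) = x correspond to the neighbours y of x (e = (x,y), ebar = (y,x)). *)
Record graph := Graph {
  V : Type;
  V_eq_dec : forall x y : V, {x = y} + {x <> y};
  nbr : V -> list V
}.

Section GraphDefs.
Variable G : graph.
Notation V := (V G).

Definition simple_graph : Prop :=
  (forall x, NoDup (nbr G x)) /\
  (forall x, ~ In x (nbr G x)) /\
  (forall x y, In y (nbr G x) <-> In x (nbr G y)).

Definition countable_vertices : Prop :=
  exists f : V -> nat, forall x y, f x = f y -> x = y.

Definition deg (x : V) : nat := length (nbr G x).

Fixpoint is_walk (x : V) (l : list V) (y : V) : Prop :=
  match l with
  | [] => x = y
  | z :: l' => In z (nbr G x) /\ is_walk z l' y
  end.

Definition connected : Prop := forall x y : V, exists l, is_walk x l y.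

Definition bounded_degree : Prop := exists K : nat, forall x, (deg x <= K)%nat.

Definition no_degree_one : Prop := forall x, deg x <> 1%nat.

Definition is_sup_degree (M : nat) : Prop :=
  (forall x, (deg x <= M)%nat) /\ (exists x, deg x = M).

(* Operators, acting on all functions V -> C (on finitely supported    *)
(* functions such as delta_{x0} they agree with the l^2 operators).    *)

Definition op := (V -> C) -> (V -> C).

Definition delta (x0 : V) : V -> C :=
  fun y => if V_eq_dec G y x0 then RtoC 1 else RtoC 0.

Definition entry (B : op) (x0 x : V) : C := B (delta x0) x.

Fixpoint Csum_list (l : list V) (F : V -> C) : C :=
  match l with
  | [] => RtoC 0
  | y :: l' => (F y + Csum_list l' F)%C
  end.

Definition opI : op := fun g => g.
Definition opA : op := fun g x => Csum_list (nbr G x) g.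
Definition opD : op := fun g x => (RtoC (INR (deg x)) * g x)%C.
Definition opadd (B1 B2 : op) : op := fun g x => (B1 g x + B2 g x)%C.
Definition opsub (B1 B2 : op) : op := fun g x => (B1 g x - B2 g x)%C.
Definition opscal (c : C) (B : op) : op := fun g x => (c * B g x)%C.
Definition opcomp (B1 B2 : op) : op := fun g => B1 (B2 g).
Fixpoint oppow (B : op) (n : nat) : op :=
  match n with
  | O => opI
  | S n' => opcomp B (oppow B n')
  end.
Definition opmult (r : V -> C) : op := fun g x => (r x * g x)%C.

Definition opLap : op := opsub opD opA.
Definition opQ : op := opsub opD opI.
Definition opAD : op := opsub (opcomp opA opD) (opcomp opD opA).

Definition opf (z : C) : op := opsub (opscal z opA) (opscal (z * z)%C opQ).

Definition log_I_minus_entry (g : op) (x0 x : V) : C :=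
  (- CSeries (fun k => entry (oppow g (S k)) x0 x / RtoC (INR (S k))))%C.

Definition log_I_minus_series (g : op) (x0 x : V) : nat -> C :=
  fun k => (entry (oppow g (S k)) x0 x / RtoC (INR (S k)))%C.

(* (C_m g)(x) = sum of g(t(c)) over geodesic (non-backtracking) paths c of
   length m with o(c) = x.  geo_sum k prev cur g sums g(t(c')) over the
   geodesic continuations c' of length k starting at cur whose first edge
   is not the reverse of the edge prev -> cur. *)
Fixpoint geo_sum (k : nat) (prev : option V) (cur : V) (g : V -> C) : C :=
  match k with
  | O => g cur
  | S k' =>
      Csum_list (nbr G cur)
        (fun y => match prev with
                  | Some p => if V_eq_dec G y p then RtoC 0
                              else geo_sum k' (Some cur) y g
                  | None => geo_sum k' (Some cur) y g
                  end)
  end.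

Definition opC (m : nat) : op := fun g x => geo_sum m None x g.

(* c_k(x) = number of geodesic loops of length k at x
          = sum over geodesic paths c of length k from x of [t(c) = x] *)
Definition nloops (k : nat) (x : V) : C := opC k (delta x) x.

Fixpoint opsum_range (a b : nat) (F : nat -> op) : op :=
  (* sum_{j = a}^{a + b - 1} F j *)
  match b with
  | O => fun g x => RtoC 0
  | S b' => opadd (F a) (opsum_range (S a) b' F)
  end.

Definition opB (m : nat) : op :=
  if (m <=? 2)%nat then opC m
  else opsub (opC m)
         (opcomp (opsub opQ opI)
            (opsum_range 1 (Nat.div m 2) (fun j => opC (m - 2 * j)))).

Fixpoint Csum_nat (a b : nat) (F : nat -> C) : C :=
  (* sum_{j = a}^{a + b - 1} F j *)
  match b with
  | O => RtoC 0
  | S b' => (F a + Csum_nat (S a) b' F)%C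
  end.

Definition Lapfun (c : V -> C) (x : V) : C :=
  (RtoC (INR (deg x)) * c x - Csum_list (nbr G x) c)%C.

Definition ceil_half (m : nat) : nat := Nat.div (m + 1) 2.

Definition opR (m : nat) : op :=
  if (m <=? 2)%nat then (fun g x => RtoC 0)
  else opmult (fun x =>
         Csum_nat 1 (ceil_half m - 1)
           (fun j => (RtoC (INR j) * Lapfun (nloops (m - 2 * j)) x)%C)).

Definition opRplus (m : nat) : op :=
  if (m <=? 2)%nat then (fun g x => RtoC 0)
  else opadd (if Nat.even m then opsub opQ opI else (fun g x => RtoC 0))
             (opR m).

Definition opN (m : nat) : op := opadd (opB m) (opRplus m).

Definition Zseries (u : C) (x0 x : V) : nat -> C :=
  fun k => (entry (opN (S k)) x0 x / RtoC (INR (S k)) * Cpow u (S k))%C.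

Definition ZX (u : C) (x0 x : V) : C := Cexp (CSeries (Zseries u x0 x)).

Definition Rseries (u : C) (x0 x : V) : nat -> C :=
  fun k => (entry (opR (k + 3)) x0 x / RtoC (INR (k + 3)) * Cpow u (k + 3))%C.

Definition integrand (x0 x : V) (z : C) : C :=
  (z * z * CSeries (fun k =>
     let n := S k in
     / RtoC (INR n) *
     Csum_nat 1 (n - 1) (fun j =>
        RtoC (INR j) *
        entry (opcomp (oppow (opf z) (n - 1 - j))
                 (opcomp opAD (oppow (opf z) (j - 1)))) x0 x)))%C.

(* the operator  (D_X - Delta_X) u - (D_X - I) u^2, so that
   I - (D_X - Delta_X) u + (D_X - I) u^2 = I - g_u *)
Definition g_log (u : C) : op :=
  opsub (opscal u (opsub opD opLap)) (opscal (u * u)%C (opsub opD opI)).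

End GraphDefs.

Definition alpha (M : nat) : R :=
  (INR M + sqrt (INR M ^ 2 + 4 * INR M)) / 2.

(* Main.v *)
Require Import Defs.
From Stdlib Require Import Reals Lra Lia List FunctionalExtensionality.
From Coquelicot Require Import Coquelicot.
Open Scope R_scope.

(* For [|z| < 1/alpha] the operator [f(z)] has norm [< 1] on bounded functions, and
   the recursion for non-backtracking paths shows that [(I - f(z))^(-1)] is the power
   series whose coefficients [S_m] satisfy [S_(m+1) = A S_m - Q S_(m-1)] and
   [C_m = S_m - S_(m-2)].  Hence, apart from the [R_m] and the even terms [Q - I], the
   coefficients [N_m] generate [f'(z) (I - f(z))^(-1) = sum_n f'(z) f(z)^n].  Moving [f']
   to the left in the derivative of [f(z)^n], at the cost of
   [f f' = f' f - z^2 [A,D]], turns this into the derivative of [-log(I - f(z))] plus the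
   commutator integrand; everything is integrated termwise along [z = t u],
   [0 <= t <= 1], and the even terms give [-(1/2) log(1 - u^2)]. *)


(** In the sup norm both [A] and [Q] are bounded by [M], directly from the degrees, so [f(z)] has
    norm at most [M (|z| + |z|^2)]. This is below 1 exactly for [|z| < 1/alpha], because [alpha] is
    the positive root of [a^2 = M a + M]. The obstacle is that [A] and [Q] need not commute: powers
    of [f(z)] cannot be expanded by commutative algebra, and [(f^n)'] is in general not
    [n f' f^(n-1)]. The power series of the inverse is therefore identified by uniqueness: it and
    the Neumann series are both bounded solutions [h] of [h = g + f(z) h]. The operators are always
    applied to one fixed function [g], in the end [delta x0], so only complex-valued functions of
    the real parameter [t] are differentiated or integrated, and each value of [A] is a finite sum
    over neighbours. *)

Lemma C_ext (a b : C) : Re a = Re b -> Im a = Im b -> a = b.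
Proof. destruct a, b; simpl; intros; subst; reflexivity. Qed.

Lemma Cmod_le_abs (c : C) : Cmod c <= Rabs (Re c) + Rabs (Im c).
Proof.
  replace c with (RtoC (Re c) + RtoC (Im c) * Ci)%C at 1.
  - eapply Rle_trans; [apply Cmod_triangle|].
    rewrite Cmod_mult, Cmod_Ci, !Cmod_R; lra.
  - apply C_ext; destruct c; simpl; ring.
Qed.

Lemma im_le_Cmod (c : C) : Rabs (Im c) <= Cmod c.
Proof.
  eapply Rle_trans; [apply (Rmax_r (Rabs (fst c)))|apply Rmax_Cmod].
Qed.

(** * Complex series, derivatives and integrals, componentwise *)

(** Componentwise, to match [CSeries] and to reuse the real theory; [has_sum_Cex] returns to
    convergence in C. *)
Definition has_sum (a : nat -> C) (l : C) : Prop :=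
  is_series (fun n => Re (a n)) (Re l) /\ is_series (fun n => Im (a n)) (Im l).

Lemma has_sum_CSeries a l : has_sum a l -> CSeries a = l.
Proof.
  intros [H1 H2]; unfold CSeries.
  rewrite (is_series_unique _ _ H1), (is_series_unique _ _ H2).
  destruct l; reflexivity.
Qed.

Lemma has_sum_unique a l l' : has_sum a l -> has_sum a l' -> l = l'.
Proof. intros H H'; rewrite <- (has_sum_CSeries _ _ H); apply has_sum_CSeries, H'. Qed.

Lemma sum_n_Re_Im (a : nat -> C) n :
  @sum_n C_AbelianMonoid a n =
  (@sum_n R_AbelianMonoid (fun k => Re (a k)) n, @sum_n R_AbelianMonoid (fun k => Im (a k)) n).
Proof.
  induction n as [|n IH].
  - etransitivity; [exact (sum_O (G := C_AbelianMonoid) a)|].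
    rewrite !(sum_O (G := R_AbelianMonoid)); now destruct (a O).
  - etransitivity; [exact (sum_Sn (G := C_AbelianMonoid) a n)|].
    rewrite !(sum_Sn (G := R_AbelianMonoid)).
    exact (f_equal (fun s : C => Cplus s (a (S n))) IH).
Qed.

Lemma has_sum_Cex a l : has_sum a l -> Cex_series a.
Proof.
  intros [H1 H2]; exists l; intros P [eps He].
  pose proof (H1 _ (locally_ball (Re l) eps)) as E1.
  pose proof (H2 _ (locally_ball (Im l) eps)) as E2.
  unfold filtermap in *.
  refine (filter_imp _ _ _ (filter_and _ _ E1 E2)).
  intros n [B1 B2]; apply He.
  change (@ball C_UniformSpace l eps (@sum_n C_AbelianMonoid a n)).
  rewrite (sum_n_Re_Im a n); split; [exact B1|exact B2].
Qed.

Lemma has_sum_ext a b l : (forall n, a n = b n) -> has_sum a l -> has_sum b l.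
Proof.
  intros E [H1 H2]; split; (eapply is_series_ext; [|eassumption]); intros n; simpl; now rewrite E.
Qed.

Lemma has_sum_plus a b l m :
  has_sum a l -> has_sum b m -> has_sum (fun n => a n + b n)%C (l + m)%C.
Proof.
  intros [H1 H2] [K1 K2]; split.
  - exact (is_series_plus _ _ _ _ H1 K1).
  - exact (is_series_plus _ _ _ _ H2 K2).
Qed.

Lemma has_sum_scal c a l : has_sum a l -> has_sum (fun n => c * a n)%C (c * l)%C.
Proof.
  intros [H1 H2]; split; simpl.
  - exact (is_series_minus _ _ _ _ (is_series_scal (Re c) _ _ H1) (is_series_scal (Im c) _ _ H2)).
  - exact (is_series_plus _ _ _ _ (is_series_scal (Re c) _ _ H2) (is_series_scal (Im c) _ _ H1)).
Qed.

Lemma has_sum_minus a b l m :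
  has_sum a l -> has_sum b m -> has_sum (fun n => a n - b n)%C (l - m)%C.
Proof.
  intros H K.
  replace (l - m)%C with (l + (- RtoC 1) * m)%C by ring.
  apply (has_sum_ext (fun n => a n + (- RtoC 1) * b n)%C); [intros n; ring|].
  exact (has_sum_plus _ _ _ _ H (has_sum_scal (- RtoC 1)%C _ _ K)).
Qed.

Lemma has_sum_zero : has_sum (fun _ => RtoC 0) (RtoC 0).
Proof.
  assert (H : is_series (fun _ : nat => 0) 0).
  { apply (filterlim_ext (fun _ => 0)); [|apply filterlim_const].
    intros n; induction n as [|n IH]; [now rewrite sum_O|].
    rewrite sum_Sn, <- IH; unfold plus; simpl; ring. }
  split; exact H.
Qed.

Lemma has_sum_incr_1 a l : has_sum (fun n => a (S n)) l -> has_sum a (a O + l)%C.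
Proof.
  intros [H1 H2]; split.
  - apply (is_series_decr_1 (fun n => Re (a n))).
    replace (plus _ _) with (Re l); [exact H1|].
    change (Re l = Re (a O) + Re l + - Re (a O)); ring.
  - apply (is_series_decr_1 (fun n => Im (a n))).
    replace (plus _ _) with (Im l); [exact H2|].
    change (Im l = Im (a O) + Im l + - Im (a O)); ring.
Qed.

Lemma has_sum_dominated a b :
  (forall n, Cmod (a n) <= b n) -> ex_series b -> has_sum a (CSeries a).
Proof.
  intros H Hb; split; simpl; apply Series_correct.
  - apply (ex_series_le (K := R_AbsRing) (V := R_CompleteNormedModule) _ b); [|exact Hb].
    intros n; eapply Rle_trans; [apply re_le_Cmod|apply H].
  - apply (ex_series_le (K := R_AbsRing) (V := R_CompleteNormedModule) _ b); [|exact Hb].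
    intros n; eapply Rle_trans; [apply im_le_Cmod|apply H].
Qed.

Lemma Series_abs_le a b :
  (forall n, Rabs (a n) <= b n) -> ex_series b -> Rabs (Series a) <= Series b.
Proof.
  intros H Hb.
  eapply Rle_trans; [apply Series_Rabs|].
  - apply (ex_series_le (K := R_AbsRing) (V := R_CompleteNormedModule) _ b); [|exact Hb].
    intros n; simpl; change norm with Rabs; now rewrite Rabs_Rabsolu.
  - apply Series_le; [|exact Hb].
    intros n; split; [apply Rabs_pos|apply H].
Qed.

(** The factor 2 comes from bounding the two components separately; it is harmless, since only
    boundedness of the sum matters later. *)
Lemma CSeries_bound a b :
  (forall n, Cmod (a n) <= b n) -> ex_series b -> Cmod (CSeries a) <= 2 * Series b.
Proof.
  intros H Hb.
  eapply Rle_trans; [apply Cmod_le_abs|]; simpl.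
  assert (Rabs (Series (fun n => Re (a n))) <= Series b).
  { apply Series_abs_le; [|exact Hb]; intros n.
    eapply Rle_trans; [apply re_le_Cmod|apply H]. }
  assert (Rabs (Series (fun n => Im (a n))) <= Series b).
  { apply Series_abs_le; [|exact Hb]; intros n.
    eapply Rle_trans; [apply im_le_Cmod|apply H]. }
  lra.
Qed.

Definition Cderiv (F : R -> C) (t : R) (l : C) : Prop :=
  is_derive (fun s => Re (F s)) t (Re l) /\ is_derive (fun s => Im (F s)) t (Im l).

Definition Ccontinuous (F : R -> C) (t : R) : Prop :=
  continuous (fun s => Re (F s)) t /\ continuous (fun s => Im (F s)) t.

Lemma Cderiv_continuous F t l : Cderiv F t l -> Ccontinuous F t.
Proof.
  intros [H1 H2]; split; apply (ex_derive_continuous (K := R_AbsRing) (V := R_NormedModule)).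
  - now exists (Re l).
  - now exists (Im l).
Qed.

Lemma Cderiv_const c t : Cderiv (fun _ => c) t (RtoC 0).
Proof. split; apply (is_derive_const (K := R_AbsRing) (V := R_NormedModule)). Qed.

Lemma Cderiv_plus F G t l m :
  Cderiv F t l -> Cderiv G t m -> Cderiv (fun s => F s + G s)%C t (l + m)%C.
Proof.
  intros [H1 H2] [K1 K2]; split.
  - exact (is_derive_plus _ _ _ _ _ H1 K1).
  - exact (is_derive_plus _ _ _ _ _ H2 K2).
Qed.

Lemma is_derive_Rmult (f g : R -> R) x df dg :
  is_derive f x df -> is_derive g x dg ->
  is_derive (fun s => f s * g s) x (df * g x + f x * dg).
Proof.
  intros H K.
  exact (is_derive_mult (K := R_AbsRing) f g x df dg H K Rmult_comm).
Qed.

Lemma Cderiv_mult F G t l m :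
  Cderiv F t l -> Cderiv G t m ->
  Cderiv (fun s => F s * G s)%C t (l * G t + F t * m)%C.
Proof.
  intros [H1 H2] [K1 K2]; split.
  - replace (Re _) with
      ((Re l * Re (G t) + Re (F t) * Re m) - (Im l * Im (G t) + Im (F t) * Im m))
      by (unfold Re, Im; simpl; ring).
    exact (is_derive_minus _ _ _ _ _ (is_derive_Rmult _ _ _ _ _ H1 K1)
             (is_derive_Rmult _ _ _ _ _ H2 K2)).
  - replace (Im _) with
      ((Re l * Im (G t) + Re (F t) * Im m) + (Im l * Re (G t) + Im (F t) * Re m))
      by (unfold Re, Im; simpl; ring).
    exact (is_derive_plus _ _ _ _ _ (is_derive_Rmult _ _ _ _ _ H1 K2)
             (is_derive_Rmult _ _ _ _ _ H2 K1)).
Qed.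

Lemma Cderiv_eq F t l m : Cderiv F t l -> l = m -> Cderiv F t m.
Proof. intros H E; now rewrite <- E. Qed.

Lemma Cderiv_ext F G t l : (forall s, F s = G s) -> Cderiv F t l -> Cderiv G t l.
Proof. intros E H; now replace G with F by (apply functional_extensionality, E). Qed.

Lemma Cderiv_scal c F t l : Cderiv F t l -> Cderiv (fun s => c * F s)%C t (c * l)%C.
Proof.
  intros H; eapply Cderiv_eq; [apply (Cderiv_mult _ _ _ _ _ (Cderiv_const c t) H)|].
  simpl; ring.
Qed.

Lemma Cderiv_line u t : Cderiv (fun s => RtoC s * u)%C t u.
Proof.
  split; simpl.
  - auto_derive; [trivial|simpl; unfold Re; ring].
  - auto_derive; [trivial|simpl; unfold Im; ring].
Qed.

Lemma Cderiv_line_pow u n t :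
  Cderiv (fun s => Cpow (RtoC s * u) (S n))%C t
    (RtoC (INR (S n)) * u * Cpow (RtoC t * u) n)%C.
Proof.
  induction n as [|n IH].
  - eapply Cderiv_eq.
    + apply (Cderiv_ext (fun s => RtoC s * u)%C); [|apply Cderiv_line].
      intros s; simpl; ring.
    + simpl; ring.
  - eapply Cderiv_eq.
    + apply (Cderiv_mult _ _ _ _ _ (Cderiv_line u t) IH).
    + rewrite (S_INR (S n)), RtoC_plus; rewrite (Cpow_S _ n); ring.
Qed.

Lemma Ccontinuous_plus F G t :
  Ccontinuous F t -> Ccontinuous G t -> Ccontinuous (fun s => F s + G s)%C t.
Proof.
  intros [H1 H2] [K1 K2]; split; simpl.
  - exact (continuous_plus _ _ _ H1 K1).
  - exact (continuous_plus _ _ _ H2 K2).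
Qed.

Lemma Ccontinuous_mult F G t :
  Ccontinuous F t -> Ccontinuous G t -> Ccontinuous (fun s => F s * G s)%C t.
Proof.
  intros [H1 H2] [K1 K2]; split; simpl.
  - apply (continuous_minus (V := R_NormedModule));
      apply (continuous_mult (K := R_AbsRing)); assumption.
  - apply (continuous_plus (V := R_NormedModule));
      apply (continuous_mult (K := R_AbsRing)); assumption.
Qed.

Lemma Ccontinuous_const c t : Ccontinuous (fun _ => c) t.
Proof. apply (Cderiv_continuous _ _ _ (Cderiv_const c t)). Qed.

Lemma Ccontinuous_line u t : Ccontinuous (fun s => RtoC s * u)%C t.
Proof. apply (Cderiv_continuous _ _ _ (Cderiv_line u t)). Qed.

Lemma Ccontinuous_ext F G t : (forall s, F s = G s) -> Ccontinuous F t -> Ccontinuous G t.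
Proof. intros E H; now replace G with F by (apply functional_extensionality, E). Qed.

Definition has_int (F : R -> C) (l : C) : Prop :=
  is_RInt (fun t => Re (F t)) 0 1 (Re l) /\ is_RInt (fun t => Im (F t)) 0 1 (Im l).

Lemma has_int_RInt F l :
  has_int F l -> RInt (V := C_R_CompleteNormedModule) F 0 1 = l.
Proof.
  intros [H1 H2]; apply is_RInt_unique.
  replace l with ((Re l, Im l) : C) by (destruct l; reflexivity).
  exact (is_RInt_fct_extend_pair (U := R_NormedModule) (V := R_NormedModule) F 0 1 _ _ H1 H2).
Qed.

Lemma has_int_unique F l m : has_int F l -> has_int F m -> l = m.
Proof. intros H K; rewrite <- (has_int_RInt _ _ H); now apply has_int_RInt. Qed.

Lemma has_int_ext F G l :
  (forall t, 0 <= t <= 1 -> F t = G t) -> has_int F l -> has_int G l.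
Proof.
  intros E [H1 H2]; split; (eapply is_RInt_ext; [|eassumption]);
    rewrite Rmin_left, Rmax_right by lra; intros t Ht; simpl; rewrite E; trivial; lra.
Qed.

Lemma has_int_minus F G l m :
  has_int F l -> has_int G m -> has_int (fun t => F t - G t)%C (l - m)%C.
Proof.
  intros [H1 H2] [K1 K2]; split.
  - exact (is_RInt_minus _ _ _ _ _ _ H1 K1).
  - exact (is_RInt_minus _ _ _ _ _ _ H2 K2).
Qed.

Lemma has_int_deriv F F' :
  (forall t, 0 <= t <= 1 -> Cderiv F t (F' t)) ->
  (forall t, 0 <= t <= 1 -> Ccontinuous F' t) ->
  has_int F' (F 1 - F 0)%C.
Proof.
  intros D K; split.
  - apply (is_RInt_derive (V := R_CompleteNormedModule) (fun t => Re (F t)));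
      rewrite Rmin_left, Rmax_right by lra; intros t Ht; [apply D|apply K]; exact Ht.
  - apply (is_RInt_derive (V := R_CompleteNormedModule) (fun t => Im (F t)));
      rewrite Rmin_left, Rmax_right by lra; intros t Ht; [apply D|apply K]; exact Ht.
Qed.

Lemma has_int_continuous F :
  (forall t, 0 <= t <= 1 -> Ccontinuous F t) -> exists l, has_int F l.
Proof.
  intros K.
  destruct (ex_RInt_continuous (V := R_CompleteNormedModule) (fun t => Re (F t)) 0 1) as [a Ha].
  { rewrite Rmin_left, Rmax_right by lra; intros t Ht; now apply K. }
  destruct (ex_RInt_continuous (V := R_CompleteNormedModule) (fun t => Im (F t)) 0 1) as [b Hb].
  { rewrite Rmin_left, Rmax_right by lra; intros t Ht; now apply K. }
  exists (a, b); split; assumption.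
Qed.

(** The Weierstrass estimate: the right-hand side does not see [a], so it is uniform in any
    parameter on which [a] depends. *)
Lemma Series_tail_le a b n :
  (forall k, Rabs (a k) <= b k) -> ex_series b ->
  Rabs (sum_n a n - Series a) <= Series b - sum_n b n.
Proof.
  intros H Hb.
  assert (Ha : ex_series a).
  { now apply (ex_series_le (K := R_AbsRing) (V := R_CompleteNormedModule) a b). }
  rewrite (Series_incr_n a (S n)) by (lia || exact Ha).
  rewrite (Series_incr_n b (S n)) by (lia || exact Hb).
  simpl pred; rewrite !sum_n_Reals.
  replace (sum_f_R0 a n - (sum_f_R0 a n + Series (fun k => a (S n + k)%nat)))
    with (- Series (fun k => a (S n + k)%nat)) by ring.
  replace (sum_f_R0 b n + Series (fun k => b (S n + k)%nat) - sum_f_R0 b n)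
    with (Series (fun k => b (S n + k)%nat)) by ring.
  rewrite Rabs_Ropp; apply Series_abs_le.
  - intros k; apply H.
  - now apply (ex_series_incr_n b (S n)).
Qed.

(* The uniform convergence needed by [filterlim_RInt] is on all of R,
   hence the functions are first frozen outside [0,1]. *)
Lemma is_RInt_series (g : nat -> R -> R) (b I : nat -> R) :
  (forall n, is_RInt (g n) 0 1 (I n)) ->
  (forall n t, 0 <= t <= 1 -> Rabs (g n t) <= b n) -> ex_series b ->
  exists L, is_series I L /\ is_RInt (fun t => Series (fun n => g n t)) 0 1 L.
Proof.
  intros HI Hg Hb.
  set (cl := fun t => Rmax 0 (Rmin 1 t)).
  assert (Hcl : forall t, 0 <= cl t <= 1).
  { intros t; unfold cl, Rmax, Rmin; destruct (Rle_dec 1 t);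
      match goal with |- context [Rle_dec ?a ?b] => destruct (Rle_dec a b) end; lra. }
  assert (Hid : forall t, 0 < t < 1 -> cl t = t).
  { intros t Ht; unfold cl; rewrite Rmin_right, Rmax_right; lra. }
  destruct (filterlim_RInt (V := R_CompleteNormedModule)
      (fun N t => sum_n (fun n => g n (cl t)) N) 0 1 eventually _
      (fun t => Series (fun n => g n (cl t))) (fun N => sum_n I N)) as [L [HL1 HL2]].
  - intros N; induction N as [|N IH].
    + apply (is_RInt_ext (g O)).
      * rewrite Rmin_left, Rmax_right by lra; intros t Ht.
        now rewrite sum_O, Hid.
      * rewrite sum_O; apply HI.
    + apply (is_RInt_ext (fun t => plus (sum_n (fun n => g n (cl t)) N) (g (S N) t))).
      * rewrite Rmin_left, Rmax_right by lra; intros t Ht.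
        now rewrite sum_Sn, (Hid t).
      * rewrite sum_Sn; apply (is_RInt_plus (V := R_NormedModule)); [exact IH|apply HI].
  - intros P [eps HP].
    destruct Hb as [B HB].
    pose proof (HB _ (locally_ball B eps)) as E; unfold filtermap in E.
    refine (filter_imp _ _ _ E); intros N HN; apply HP; intros t.
    apply Rle_lt_trans with (Series b - sum_n b N).
    + apply Series_tail_le; [intros k; apply Hg, Hcl|now exists B].
    + rewrite (is_series_unique _ _ HB).
      apply Rle_lt_trans with (Rabs (sum_n b N - B)); [|exact HN].
      rewrite <- Rabs_Ropp; eapply Rle_trans; [|apply Rle_abs]; lra.
  - exists L; split; [exact HL1|].
    eapply is_RInt_ext; [|exact HL2].
    rewrite Rmin_left, Rmax_right by lra; intros t Ht; now rewrite Hid.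
Qed.

(** Every interchange of sum and integral goes through this lemma. The common value [L] is returned
    under both descriptions, so that it can be identified by uniqueness of either the sum or the
    integral. *)
Lemma has_int_series (g : nat -> R -> C) (b : nat -> R) (I : nat -> C) :
  (forall n, has_int (g n) (I n)) ->
  (forall n t, 0 <= t <= 1 -> Cmod (g n t) <= b n) -> ex_series b ->
  exists L, has_sum I L /\ has_int (fun t => CSeries (fun n => g n t)) L.
Proof.
  intros HI Hg Hb.
  destruct (is_RInt_series (fun n t => Re (g n t)) b (fun n => Re (I n))) as [L1 [A1 B1]]; trivial.
  { intros n; apply HI. }
  { intros n t Ht; eapply Rle_trans; [apply re_le_Cmod|now apply Hg]. }
  destruct (is_RInt_series (fun n t => Im (g n t)) b (fun n => Im (I n))) as [L2 [A2 B2]]; trivial.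
  { intros n; apply HI. }
  { intros n t Ht; eapply Rle_trans; [apply im_le_Cmod|now apply Hg]. }
  exists (L1, L2); repeat split; assumption.
Qed.

(** * The complex exponential and the principal logarithm *)

Lemma Cexp_plus a b : Cexp (a + b)%C = (Cexp a * Cexp b)%C.
Proof.
  unfold Cexp; rewrite re_plus.
  change (Im (a + b)%C) with (Im a + Im b).
  rewrite exp_plus, cos_plus, sin_plus.
  apply C_ext; simpl; ring.
Qed.

(** The right half plane is open, so near [t] the argument is given by the single branch
    [atan (Im / Re)] and both components can be differentiated directly. *)
Lemma Cderiv_Clog (p : R -> C) t l :
  0 < Re (p t) -> Cderiv p t l ->
  Cderiv (fun s => Clog (p s)) t (l / p t)%C.
Proof.
  intros Ht [D1 D2].
  assert (Hloc : locally t (fun s =>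
    ((ln (sqrt (Re (p s) ^ 2 + Im (p s) ^ 2)), atan (Im (p s) / Re (p s))) : C) = Clog (p s))).
  { assert (Hc : continuous (fun s => Re (p s)) t) by
      (apply (ex_derive_continuous (K := R_AbsRing) (V := R_NormedModule)); now exists (Re l)).
    apply (filter_imp (fun s => 0 < Re (p s))); [|exact (Hc _ (open_gt 0 _ Ht))].
    intros s Hs.
    unfold Clog, Carg, Cmod.
    destruct (Rlt_dec 0 (Re (p s))) as [_|N]; [reflexivity|now elim N]. }
  enough (Cderiv (fun s => (ln (sqrt (Re (p s) ^ 2 + Im (p s) ^ 2)),
                            atan (Im (p s) / Re (p s))) : C) t (l / p t)%C) as [E1 E2].
  { split; (eapply is_derive_ext_loc; [|eassumption]);
      refine (filter_imp _ _ _ Hloc); intros s Hs; now rewrite <- Hs. }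
  assert (Hpos : 0 < Re (p t) ^ 2 + Im (p t) ^ 2).
  { assert (0 < Re (p t) ^ 2) by (apply pow_lt; lra).
    pose proof (pow2_ge_0 (Im (p t))); lra. }
  split; simpl Re; simpl Im.
  - evar_last.
    + apply (is_derive_comp (K := R_AbsRing) (V := R_NormedModule) ln
               (fun s => sqrt (Re (p s) ^ 2 + Im (p s) ^ 2))).
      * apply is_derive_ln, sqrt_lt_R0, Hpos.
      * apply (is_derive_sqrt (fun s => Re (p s) ^ 2 + Im (p s) ^ 2)); [|exact Hpos].
        apply (is_derive_plus (fun s => Re (p s) ^ 2) (fun s => Im (p s) ^ 2));
          apply (is_derive_pow _ 2); eassumption.
    + unfold scal, plus; simpl; unfold mult; simpl.
      fold (Re (p t)) (Im (p t)).
      pose proof (sqrt_sqrt _ (Rlt_le _ _ Hpos)) as Hs.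
      pose proof (sqrt_lt_R0 _ Hpos) as Hs0.
      simpl in Hs, Hs0, Hpos.
      set (w := sqrt _) in *.
      unfold Re, Im in *.
      (* Here [w = |p t|]; multiplied by [w^2], both sides become the real part of [l] times the
         conjugate of [p t]. *)
      apply Rmult_eq_reg_r with (w * w); [|nra].
      transitivity (fst l * fst (p t) + snd l * snd (p t)); [field; lra|].
      rewrite Hs; field; nra.
  - evar_last.
    + apply (is_derive_comp (K := R_AbsRing) (V := R_NormedModule) atan
               (fun s => Im (p s) / Re (p s))).
      * apply is_derive_atan.
      * apply (is_derive_div (fun s => Im (p s)) (fun s => Re (p s)));
          [exact D2|exact D1|lra].
    + unfold scal; simpl; unfold mult; simpl; unfold Rsqr.
      unfold Re, Im in *; simpl in *.
      field; repeat split; nra.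
Qed.


(** * The operators and the geodesic recursion *)

Section Operators.
Variable G : graph.
Implicit Types g h : V G -> C.

Lemma Csum_list_ext (l : list (V G)) g h :
  (forall y, In y l -> g y = h y) -> Csum_list G l g = Csum_list G l h.
Proof.
  induction l as [|y l IH]; intros H; [reflexivity|]; simpl.
  rewrite H by (left; reflexivity).
  rewrite IH; [reflexivity|]; intros; apply H; now right.
Qed.

Lemma Csum_list_lin (l : list (V G)) a b g h :
  Csum_list G l (fun y => a * g y + b * h y)%C =
  (a * Csum_list G l g + b * Csum_list G l h)%C.
Proof. induction l as [|y l IH]; simpl; [|rewrite IH]; ring. Qed.

Lemma Csum_list_const (l : list (V G)) c :
  Csum_list G l (fun _ => c) = (RtoC (INR (length l)) * c)%C.
Proof.
  induction l as [|y l IH]; [simpl; ring|].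
  change (length (y :: l)) with (S (length l)).
  rewrite S_INR, RtoC_plus; simpl; rewrite IH; ring.
Qed.

Lemma Csum_list_bound (l : list (V G)) g K :
  (forall y, Cmod (g y) <= K) -> Cmod (Csum_list G l g) <= INR (length l) * K.
Proof.
  intros H; induction l as [|y l IH]; [simpl; rewrite Cmod_0; lra|].
  change (length (y :: l)) with (S (length l)); rewrite S_INR; simpl.
  eapply Rle_trans; [apply Cmod_triangle|]; specialize (H y); lra.
Qed.

(** In a simple graph a neighbour is listed once, so forbidding the step back to [p] costs exactly
    one term. *)
Lemma Csum_list_remove (l : list (V G)) p g :
  NoDup l -> In p l ->
  Csum_list G l (fun y => if V_eq_dec G y p then RtoC 0 else g y) =
  (Csum_list G l g - g p)%C.
Proof.
  induction l as [|y l IH]; intros N I; [destruct I|].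
  inversion N as [|? ? N1 N2]; subst; simpl.
  destruct (V_eq_dec G y p) as [E|E].
  - subst y; rewrite (Csum_list_ext l _ g); [ring|].
    intros z Hz; destruct (V_eq_dec G z p) as [E|E]; [subst; contradiction|reflexivity].
  - destruct I as [I|I]; [contradiction|]; rewrite IH by assumption; ring.
Qed.

Lemma opA_lin a b g h x :
  opA G (fun y => a * g y + b * h y)%C x = (a * opA G g x + b * opA G h x)%C.
Proof. apply Csum_list_lin. Qed.

Lemma opA_plus g h x : opA G (fun y => g y + h y)%C x = (opA G g x + opA G h x)%C.
Proof.
  transitivity (opA G (fun y => 1 * g y + 1 * h y)%C x);
    [apply Csum_list_ext; intros; ring|rewrite opA_lin; ring].
Qed.

Lemma opA_scal a g x : opA G (fun y => a * g y)%C x = (a * opA G g x)%C.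
Proof.
  transitivity (opA G (fun y => a * g y + 0 * g y)%C x);
    [apply Csum_list_ext; intros; ring|rewrite opA_lin; ring].
Qed.

Lemma opA_zero x : opA G (fun _ => RtoC 0) x = RtoC 0.
Proof. unfold opA; rewrite Csum_list_const; ring. Qed.

Lemma opQ_val g x : opQ G g x = ((RtoC (INR (deg G x)) - 1) * g x)%C.
Proof. unfold opQ, opsub, opD, opI; ring. Qed.

Lemma opf_val z g x : opf G z g x = (z * opA G g x - z * z * opQ G g x)%C.
Proof. reflexivity. Qed.

Lemma opf_lin z a b g h x :
  opf G z (fun y => a * g y + b * h y)%C x = (a * opf G z g x + b * opf G z h x)%C.
Proof. rewrite !opf_val, opA_lin, !opQ_val; ring. Qed.

Lemma g_log_opf u : g_log G u = opf G u.
Proof.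
  extensionality g; extensionality x.
  unfold g_log, opLap, opsub, opscal; rewrite opf_val; unfold opQ, opsub; ring.
Qed.

(* The derivative of [opf z] in [z]. *)
Definition opf' (z : C) : op G := fun g x => (opA G g x - 2 * z * opQ G g x)%C.

(** Only cross terms survive in the commutator of [z A - z^2 Q] with [A - 2 z Q]: they give [(-2 z^2
    + z^2) [A,Q]], and [[A,Q] = [A,D]] because [Q = D - I]. *)
Lemma opf_opf' z g x :
  opf G z (opf' z g) x = (opf' z (opf G z g) x - z * z * opAD G g x)%C.
Proof.
  unfold opf' at 2; rewrite !opf_val, !opQ_val.
  replace (opf' z g) with (fun y => 1 * opA G g y + (- (2 * z)) * opQ G g y)%C
    by (extensionality y; unfold opf'; ring).
  replace (opf G z g) with (fun y => z * opA G g y + (- (z * z)) * opQ G g y)%C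
    by (extensionality y; rewrite opf_val; ring).
  rewrite !opA_lin.
  unfold opAD, opsub, opcomp.
  replace (opD G g) with (fun y => opQ G g y + g y)%C
    by (extensionality y; rewrite opQ_val; unfold opD; ring).
  rewrite opA_plus; unfold opD; rewrite !opQ_val; ring.
Qed.

Hypothesis Hsimple : simple_graph G.

(** The discarded continuations are those stepping from [x] back to [p]; after that step they
    continue from [p] without returning to [x]. *)
Lemma geo_sum_turn k p x g : In p (nbr G x) ->
  geo_sum G (S k) (Some p) x g = (opC G (S k) g x - geo_sum G k (Some x) p g)%C.
Proof.
  intros Hp; simpl.
  rewrite (Csum_list_remove _ p (fun y => geo_sum G k (Some x) y g)); trivial.
  apply Hsimple.
Qed.

(** Split off the first edge from [x] to [y]: all geodesic paths from [y] are summed, then those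
    going straight back to [x] are removed. *)
Lemma opC_SS k g x :
  opC G (S (S k)) g x =
  (opA G (opC G (S k) g) x - Csum_list G (nbr G x) (fun y => geo_sum G k (Some y) x g))%C.
Proof.
  change (opC G (S (S k)) g x)
    with (Csum_list G (nbr G x) (fun y => geo_sum G (S k) (Some x) y g)).
  transitivity (Csum_list G (nbr G x) (fun y =>
    1 * opC G (S k) g y + (- RtoC 1) * geo_sum G k (Some y) x g)%C).
  - apply Csum_list_ext; intros y Hy.
    rewrite geo_sum_turn; [ring|now apply Hsimple].
  - rewrite Csum_list_lin; unfold opA; ring.
Qed.

(** Length two is exceptional: after going out and back nothing is left to constrain, so all [deg x]
    such paths are subtracted and [D] appears instead of [Q]. *)
Lemma opC_2 g x : opC G 2 g x = (opA G (opA G g) x - opD G g x)%C.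
Proof.
  rewrite opC_SS; change (opC G 1 g) with (opA G g).
  simpl geo_sum; rewrite Csum_list_const; reflexivity.
Qed.

(** A geodesic path of length [k + 1] from [x] is subtracted once for each neighbour [y] of [x]
    other than its own second vertex, hence [deg x - 1] times; this is [Q]. *)
Lemma opC_SSS k g x :
  opC G (S (S (S k))) g x =
  (opA G (opC G (S (S k)) g) x - opQ G (opC G (S k) g) x)%C.
Proof.
  rewrite opC_SS; f_equal; f_equal.
  transitivity (Csum_list G (nbr G x) (fun y =>
    1 * opC G (S k) g x + (- RtoC 1) * geo_sum G k (Some x) y g)%C).
  - apply Csum_list_ext; intros y Hy; rewrite geo_sum_turn; [ring|exact Hy].
  - rewrite Csum_list_lin, Csum_list_const.
    change (Csum_list G (nbr G x) (fun y => geo_sum G k (Some x) y g)) with (opC G (S k) g x).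
    rewrite opQ_val; unfold deg; ring.
Qed.

(* The coefficients of the power series of (I - f(z))^(-1); see [inverse_series]. *)
Fixpoint inv_coef (m : nat) : op G :=
  match m with
  | O => opI G
  | S m' => fun g x => (opA G (inv_coef m' g) x -
      match m' with O => RtoC 0 | S m'' => opQ G (inv_coef m'' g) x end)%C
  end.

(** The convention [S_(-1) = 0], which makes the three-term recursion uniform. *)
Definition inv_coef_pred (m : nat) : op G :=
  match m with O => fun _ _ => RtoC 0 | S m' => inv_coef m' end.

Lemma inv_coef_S m g x :
  inv_coef (S m) g x = (opA G (inv_coef m g) x - opQ G (inv_coef_pred m g) x)%C.
Proof. destruct m; simpl; [rewrite opQ_val; ring|reflexivity]. Qed.

(** Both sides obey the same recursion once the length is at least 3, and adding [S_0 = I] absorbs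
    the exception at length 2: [A^2 - D + I = A^2 - Q]. Two consecutive indices are carried through
    the induction. *)
Lemma opC_inv_coef m g x :
  (opC G (S (S m)) g x + inv_coef m g x)%C = inv_coef (S (S m)) g x.
Proof.
  revert x.
  enough (H : (forall x, (opC G (S (S m)) g x + inv_coef m g x)%C = inv_coef (S (S m)) g x) /\
          (forall x, (opC G (S (S (S m))) g x + inv_coef (S m) g x)%C = inv_coef (S (S (S m))) g x))
    by apply H.
  assert (E1 : inv_coef 1 g = opA G g).
  { extensionality x; simpl; change (opI G g) with g; ring. }
  assert (B : forall x, (opC G 2 g x + inv_coef 0 g x)%C = inv_coef 2 g x).
  { intros x; rewrite (inv_coef_S 1), E1, opC_2, opQ_val; simpl; unfold opI, opD; ring. }
  induction m as [|m [IH1 IH2]]; split; trivial.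
  - intros x; rewrite opC_SSS, (inv_coef_S 2).
    replace (inv_coef 2 g) with (fun y => opC G 2 g y + inv_coef 0 g y)%C
      by (extensionality y; apply B).
    rewrite opA_plus, E1; unfold inv_coef_pred; rewrite E1.
    change (inv_coef 0 g) with g; change (opC G 1 g) with (opA G g); ring.
  - intros x; rewrite opC_SSS, (inv_coef_S (S (S (S m)))).
    replace (inv_coef (S (S (S m))) g) with (fun y => opC G (S (S (S m))) g y + inv_coef (S m) g y)%C
      by (extensionality y; apply IH2).
    rewrite opA_plus; unfold inv_coef_pred.
    rewrite (inv_coef_S (S m)), !opQ_val, <- IH1; unfold inv_coef_pred; ring.
Qed.

Lemma opsum_range_S a b (F : nat -> op G) g x :
  opsum_range G a (S b) F g x = (F a g x + opsum_range G (S a) b F g x)%C.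
Proof. reflexivity. Qed.

Lemma opsum_range_shift a b (F : nat -> op G) :
  opsum_range G (S a) b F = opsum_range G a b (fun j => F (S j)).
Proof.
  revert a; induction b as [|b IH]; intros a; [reflexivity|]; simpl; now rewrite IH.
Qed.

(** The sum is [C_m + C_(m-2) + ...], which telescopes because [C_k = S_k - S_(k-2)]; it ends with
    [C_0 = S_0] or [C_1 = S_1]. *)
Lemma opsum_opC m g :
  opsum_range G 1 (Nat.div (S (S m)) 2) (fun j => opC G (S (S m) - 2 * j)) g = inv_coef m g.
Proof.
  enough (H : forall k, (k = m \/ k = S m) ->
    opsum_range G 1 (Nat.div (S (S k)) 2) (fun j => opC G (S (S k) - 2 * j)) g = inv_coef k g)
    by (apply H; now left).
  induction m as [|m IH]; intros k [E|E]; subst k.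
  - extensionality x; unfold opsum_range, opadd; simpl; unfold opC, opI; simpl; ring.
  - extensionality x; change (Nat.div 3 2) with 1%nat; unfold opsum_range, opadd.
    change (opC G (3 - 2 * 1) g x) with (opA G g x); simpl; unfold opI at 1.
    change (fun x => g x) with g; change (opI G g) with g; ring.
  - apply IH; now right.
  - replace (Nat.div (S (S (S (S m)))) 2) with (S (Nat.div (S (S m)) 2))
      by (change (S (S (S (S m)))) with (2 + S (S m))%nat;
          rewrite (Nat.add_comm 2), (Nat.div_add _ 1 2) by lia; lia).
    extensionality x; rewrite opsum_range_S, opsum_range_shift, <- opC_inv_coef.
    replace (S (S (S (S m))) - 2 * 1)%nat with (S (S m)) by lia; f_equal.
    rewrite <- (IH m) by now left.
    replace (fun j => opC G (S (S (S (S m))) - 2 * S j))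
      with (fun j => opC G (S (S m) - 2 * j)); [reflexivity|].
    extensionality j; replace (S (S (S (S m))) - 2 * S j)%nat with (S (S m) - 2 * j)%nat by lia.
    reflexivity.
Qed.

(* The coefficient of [z^m] in [f'(z) (I - f(z))^(-1)], hence the main part of
   [N_(m+1)], with a shift of index. *)
Definition fB_coef (m : nat) : op G :=
  fun g x => (opA G (inv_coef m g) x - 2 * opQ G (inv_coef_pred m g) x)%C.

(** For length [m + 1 >= 3], [C_(m+1) - (Q - I) S_(m-1) = S_(m+1) - Q S_(m-1) = A S_m - 2 Q
    S_(m-1)]. At length 2 the defining correction is 0, yet the even term [Q - I = D - 2] still
    appears, since [A^2 - D = (A^2 - 2 Q) + (D - 2)]; so all even lengths behave alike. *)
Lemma opN_S m g x :
  opN G (S m) g x =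
  (fB_coef m g x + (if Nat.even (S m) then RtoC (INR (deg G x) - 2) * g x else 0)
   + opR G (S m) g x)%C.
Proof.
  unfold opN, opadd, fB_coef.
  destruct m as [|[|m]].
  - simpl; unfold opB, opRplus; simpl.
    rewrite opQ_val; change (opC G 1 g x) with (opA G g x); change (opI G g) with g.
    unfold opR; simpl; ring.
  - unfold opB, opRplus, opR; rewrite opC_2.
    replace (inv_coef 1 g) with (opA G g)
      by (extensionality y; simpl; change (opI G g) with g; ring).
    simpl Nat.even; cbv iota; simpl inv_coef_pred; rewrite opQ_val.
    unfold opI, opD; rewrite RtoC_minus; replace (2 <=? 2)%nat with true by reflexivity; ring.
  - unfold opB, opRplus; replace (S (S (S m)) <=? 2)%nat with false by reflexivity.
    unfold opsub at 1, opcomp; rewrite opsum_opC.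
    pose proof (opC_inv_coef (S m) g x) as E; rewrite (inv_coef_S (S (S m))) in E.
    replace (opC G (S (S (S m))) g x) with
      (opA G (inv_coef (S (S m)) g) x - opQ G (inv_coef_pred (S (S m)) g) x - inv_coef (S m) g x)%C
      by (rewrite <- E; ring).
    unfold opadd, opsub, opI, inv_coef_pred; rewrite !opQ_val.
    destruct (Nat.even (S (S (S m)))); rewrite ?opQ_val, ?RtoC_minus; ring.
Qed.

End Operators.


(** * Bounds and the resolvent *)

Lemma alpha_facts (M : nat) : (1 <= M)%nat ->
  0 < alpha M /\ INR M <= alpha M /\ alpha M * alpha M = INR M * alpha M + INR M.
Proof.
  intros HM; apply le_INR in HM; simpl in HM.
  unfold alpha; set (m := INR M) in *.
  assert (H0 : 0 <= m ^ 2 + 4 * m) by nra.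
  assert (H1 : m <= sqrt (m ^ 2 + 4 * m)).
  { rewrite <- (sqrt_pow2 m) at 1 by lra; apply sqrt_le_1_alt; lra. }
  pose proof (sqrt_sqrt _ H0) as H2.
  set (s := sqrt (m ^ 2 + 4 * m)) in *.
  repeat split; nra.
Qed.

Lemma ex_series_scal_geom c q : 0 <= q < 1 -> ex_series (fun n => c * q ^ n).
Proof.
  intros Hq; apply (ex_series_scal_l c (fun n => q ^ n)), ex_series_geom.
  rewrite Rabs_pos_eq; lra.
Qed.

Section Bounds.
Variable G : graph.
Variable M : nat.
Hypothesis Hsimple : simple_graph G.
Hypothesis Hdeg : forall x, (deg G x <= M)%nat.
Hypothesis HM : (1 <= M)%nat.
Implicit Types g h : V G -> C.

Definition bounded_by (K : R) (g : V G -> C) : Prop := forall y, Cmod (g y) <= K.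

Lemma delta_bounded x0 : bounded_by 1 (delta G x0).
Proof.
  intros y; unfold delta; destruct (V_eq_dec G y x0); rewrite ?Cmod_1, ?Cmod_0; lra.
Qed.

Lemma Cmod_minus_le a b : Cmod (a - b) <= Cmod a + Cmod b.
Proof. rewrite <- (Cmod_opp b); apply Cmod_triangle. Qed.

Lemma opA_bounded K g : bounded_by K g -> bounded_by (INR M * K) (opA G g).
Proof.
  intros H x; eapply Rle_trans; [apply Csum_list_bound, H|].
  apply Rmult_le_compat_r; [|apply le_INR, Hdeg].
  eapply Rle_trans; [apply Cmod_ge_0|apply (H x)].
Qed.

Lemma opQ_bounded K g : bounded_by K g -> bounded_by (INR M * K) (opQ G g).
Proof.
  intros H x; rewrite opQ_val, Cmod_mult.
  apply Rmult_le_compat; try apply Cmod_ge_0; [|apply H].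
  rewrite <- RtoC_minus, Cmod_R.
  pose proof (le_INR _ _ (Hdeg x)); pose proof (pos_INR (deg G x)).
  (* At an isolated vertex [|deg x - 1| = 1], which is still at most [M]. *)
  pose proof (le_INR _ _ HM) as HM'; simpl in HM'.
  apply Rabs_le; lra.
Qed.

(** An upper bound for the sup norm of [f(z)]. *)
Definition rate (z : C) : R := INR M * (Cmod z + Cmod z * Cmod z).

Lemma rate_pos z : 0 <= rate z.
Proof.
  pose proof (Cmod_ge_0 z); pose proof (pos_INR M); unfold rate.
  apply Rmult_le_pos; nra.
Qed.

Lemma rate_mono z w : Cmod z <= Cmod w -> rate z <= rate w.
Proof.
  intros H; pose proof (Cmod_ge_0 z); pose proof (pos_INR M).
  apply Rmult_le_compat_l; nra.
Qed.

Lemma rate_lt_1 z : Cmod z * alpha M < 1 -> rate z < 1.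
Proof.
  intros H; destruct (alpha_facts M HM) as (A0 & A1 & A2).
  pose proof (Cmod_ge_0 z) as Hz; unfold rate.
  apply (Rmult_lt_reg_r (alpha M * alpha M)); [nra|].
  pose proof (pos_INR M) as Hm.
  assert (Hs : 0 <= Cmod z * alpha M) by (apply Rmult_le_pos; lra).
  set (a := alpha M) in *; set (t := Cmod z) in *; set (m := INR M) in *.
  (* With [t a < 1]: [m (t + t^2) a^2 = t a (m a + m t a) <= t a (m a + m) = t a a^2 < a^2]. *)
  apply Rle_lt_trans with (t * a * (m * a + m));
    [|rewrite <- A2; assert (0 < a * a) by nra;
     apply Rlt_le_trans with (1 * (a * a)); [apply Rmult_lt_compat_r|]; lra].
  replace (m * (t + t * t) * (a * a)) with (t * a * (m * a + m * (t * a))) by ring.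
  apply Rmult_le_compat_l; [exact Hs|nra].
Qed.

Lemma opf_bounded z K g : bounded_by K g -> bounded_by (rate z * K) (opf G z g).
Proof.
  intros H x; rewrite opf_val.
  eapply Rle_trans; [apply Cmod_minus_le|]; rewrite !Cmod_mult.
  pose proof (opA_bounded K g H x) as H1; pose proof (opQ_bounded K g H x) as H2.
  pose proof (Cmod_ge_0 z); unfold rate.
  apply Rle_trans with (Cmod z * (INR M * K) + Cmod z * Cmod z * (INR M * K)); [|right; ring].
  apply Rplus_le_compat; apply Rmult_le_compat_l; trivial; nra.
Qed.

Lemma oppow_bounded z n g : bounded_by 1 g -> bounded_by (rate z ^ n) (oppow G (opf G z) n g).
Proof. intros H; induction n as [|n IH]; [exact H|]; simpl; now apply opf_bounded. Qed.

Lemma opf'_bounded z K g :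
  bounded_by K g -> bounded_by ((INR M + 2 * Cmod z * INR M) * K) (opf' G z g).
Proof.
  intros H x; eapply Rle_trans; [apply Cmod_minus_le|]; rewrite !Cmod_mult, Cmod_R.
  rewrite Rabs_pos_eq by lra.
  pose proof (opA_bounded K g H x) as H1; pose proof (opQ_bounded K g H x) as H2.
  pose proof (Cmod_ge_0 z).
  rewrite Rmult_plus_distr_r; apply Rplus_le_compat; [exact H1|].
  rewrite !Rmult_assoc; apply Rmult_le_compat_l; [lra|].
  now apply Rmult_le_compat_l.
Qed.

(** The recursion is majorized by [a_(m+1) = M a_m + M a_(m-1)], which the powers of [alpha]
    solve. *)
Lemma inv_coef_bounded m g : bounded_by 1 g -> bounded_by (alpha M ^ m) (inv_coef G m g).
Proof.
  intros H; destruct (alpha_facts M HM) as (A0 & A1 & A2).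
  enough (E : bounded_by (alpha M ^ m) (inv_coef G m g) /\
              bounded_by (alpha M ^ S m) (inv_coef G (S m) g)) by apply E.
  induction m as [|m [IH1 IH2]]; split; trivial.
  - intros x; rewrite inv_coef_S; eapply Rle_trans; [apply Cmod_minus_le|].
    pose proof (opA_bounded 1 g H x) as H1.
    change (inv_coef G 0 g) with g; simpl inv_coef_pred.
    rewrite opQ_val, Cmult_0_r, Cmod_0; simpl; lra.
  - intros x; rewrite inv_coef_S; eapply Rle_trans; [apply Cmod_minus_le|].
    pose proof (opA_bounded _ _ IH2 x) as H1; pose proof (opQ_bounded _ _ IH1 x) as H2.
    simpl inv_coef_pred.
    replace (alpha M ^ S (S m)) with (INR M * alpha M ^ S m + INR M * alpha M ^ m); [lra|].
    simpl; rewrite <- (Rmult_assoc (alpha M) (alpha M)), A2; ring.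
Qed.

Lemma fB_coef_bounded m g :
  bounded_by 1 g -> bounded_by (3 * INR M * alpha M ^ m) (fB_coef G m g).
Proof.
  intros H x; destruct (alpha_facts M HM) as (A0 & A1 & A2).
  pose proof (le_INR _ _ HM) as H1; simpl in H1.
  eapply Rle_trans; [apply Cmod_minus_le|].
  rewrite (Cmod_mult 2), Cmod_R, Rabs_pos_eq by lra.
  pose proof (opA_bounded _ _ (inv_coef_bounded m g H) x) as H2.
  assert (H3 : Cmod (opQ G (inv_coef_pred G m g) x) <= INR M * alpha M ^ m); [|lra].
  apply opQ_bounded; intros y; destruct m as [|m]; simpl.
  - rewrite Cmod_0; lra.
  - pose proof (inv_coef_bounded m g H y); pose proof (pow_lt _ m A0); nra.
Qed.

Lemma opC_bounded m g : bounded_by 1 g -> bounded_by (2 * alpha M ^ m) (opC G m g).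
Proof.
  intros H x; destruct (alpha_facts M HM) as (A0 & A1 & A2).
  pose proof (le_INR _ _ HM) as H1; simpl in H1.
  destruct m as [|[|m]].
  - specialize (H x); unfold opC; simpl; lra.
  - pose proof (opA_bounded _ _ H x); change (opC G 1 g x) with (opA G g x); simpl; lra.
  - replace (opC G (S (S m)) g x) with (inv_coef G (S (S m)) g x - inv_coef G m g x)%C
      by (rewrite <- (opC_inv_coef G Hsimple m); ring).
    eapply Rle_trans; [apply Cmod_minus_le|].
    pose proof (inv_coef_bounded (S (S m)) g H x); pose proof (inv_coef_bounded m g H x).
    assert (alpha M ^ m <= alpha M ^ S (S m)) by (apply Rle_pow; [lra|lia]).
    lra.
Qed.

Lemma Csum_nat_bound a b (F : nat -> C) K :
  (forall j, (a <= j < a + b)%nat -> Cmod (F j) <= K) ->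
  Cmod (Csum_nat a b F) <= INR b * K.
Proof.
  revert a; induction b as [|b IH]; intros a H; [simpl; rewrite Cmod_0; lra|].
  rewrite S_INR; simpl Csum_nat; eapply Rle_trans; [apply Cmod_triangle|].
  assert (Cmod (Csum_nat (S a) b F) <= INR b * K) by (apply IH; intros; apply H; lia).
  assert (Cmod (F a) <= K) by (apply H; lia); lra.
Qed.

(** Each summand is at most [alpha^j * 2 alpha * 2 alpha^(m-2j)], from [j <= alpha^j], [M <= alpha]
    and the bound on loop counts; as [j >= 1] its exponent [m - j + 1] does not exceed [m]. The
    factor [m] bounds the number of summands and is cancelled by the [1/m] of the series. *)
Lemma opR_bounded m g : (2 <= M)%nat -> bounded_by 1 g ->
  bounded_by (INR m * (4 * alpha M ^ m)) (opR G m g).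
Proof.
  intros H2M H x; destruct (alpha_facts M HM) as (A0 & A1 & A2).
  apply le_INR in H2M; simpl in H2M.
  assert (Ha : 0 <= 4 * alpha M ^ m) by (pose proof (pow_lt _ m A0); lra).
  unfold opR; destruct (Nat.leb_spec m 2).
  { rewrite Cmod_0; apply Rmult_le_pos; [apply pos_INR|exact Ha]. }
  unfold opmult; rewrite Cmod_mult.
  rewrite <- Rmult_1_r; apply Rmult_le_compat; try apply Cmod_ge_0; [|apply H].
  assert (Hc : (2 * ceil_half m <= m + 1)%nat) by apply Nat.Div0.mul_div_le.
  eapply Rle_trans; [apply Csum_nat_bound|
    apply Rmult_le_compat_r; [exact Ha|apply (le_INR (ceil_half m - 1)); lia]].
  intros j Hj; rewrite Cmod_mult, Cmod_R, (Rabs_pos_eq _ (pos_INR j)).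
  assert (Hloops : forall y, Cmod (nloops G (m - 2 * j) y) <= 2 * alpha M ^ (m - 2 * j)).
  { intros y; apply opC_bounded, delta_bounded. }
  assert (HL : Cmod (Lapfun G (nloops G (m - 2 * j)) x) <= 2 * INR M * (2 * alpha M ^ (m - 2 * j))).
  { eapply Rle_trans; [apply Cmod_minus_le|].
    pose proof (opA_bounded _ _ Hloops x) as K1; unfold opA in K1.
    assert (K2 : Cmod (RtoC (INR (deg G x)) * nloops G (m - 2 * j) x) <=
                 INR M * (2 * alpha M ^ (m - 2 * j))); [|lra].
    rewrite Cmod_mult, Cmod_R, Rabs_pos_eq by apply pos_INR.
    apply Rmult_le_compat; [apply pos_INR|apply Cmod_ge_0|apply le_INR, Hdeg|apply Hloops]. }
  assert (Hpow : INR j <= alpha M ^ j).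
  { clear - A1 H2M; induction j as [|j IH]; [simpl; lra|].
    rewrite S_INR; simpl. pose proof (pow_R1_Rle (alpha M) j ltac:(lra)); nra. }
  pose proof (pow_lt _ (m - 2 * j) A0) as P1.
  apply Rle_trans with (alpha M ^ j * (2 * alpha M * (2 * alpha M ^ (m - 2 * j)))).
  { apply Rmult_le_compat; [apply pos_INR|apply Cmod_ge_0|exact Hpow|].
    eapply Rle_trans; [exact HL|nra]. }
  replace (alpha M ^ j * (2 * alpha M * (2 * alpha M ^ (m - 2 * j))))
    with (4 * alpha M ^ (j + S (m - 2 * j))) by (rewrite pow_add; simpl; ring).
  apply Rmult_le_compat_l; [lra|]; apply Rle_pow; [lra|lia].
Qed.

Lemma has_sum_opA (a : nat -> V G -> C) (Y : V G -> C) x :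
  (forall y, has_sum (fun n => a n y) (Y y)) -> has_sum (fun n => opA G (a n) x) (opA G Y x).
Proof.
  intros H; unfold opA; induction (nbr G x) as [|y l IH]; simpl.
  - apply has_sum_zero.
  - now apply has_sum_plus.
Qed.

Lemma has_sum_opQ (a : nat -> V G -> C) (Y : V G -> C) x :
  (forall y, has_sum (fun n => a n y) (Y y)) -> has_sum (fun n => opQ G (a n) x) (opQ G Y x).
Proof.
  intros H; rewrite opQ_val.
  eapply has_sum_ext; [|apply has_sum_scal, H]; intros n; simpl; now rewrite opQ_val.
Qed.

(** Iterating the equation gives [d = f(z)^n d], bounded by [rate z ^ n * K], which tends to 0. *)
Lemma opf_fixed_zero z (d : V G -> C) K :
  rate z < 1 -> bounded_by K d -> (forall y, d y = opf G z d y) -> forall y, d y = RtoC 0.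
Proof.
  intros Hr HK Hd y.
  assert (Hn : forall n, bounded_by (rate z ^ n * K) d).
  { induction n as [|n IH]; [simpl; now rewrite Rmult_1_l|].
    intros w; rewrite Hd; simpl; rewrite Rmult_assoc; now apply opf_bounded. }
  apply Cmod_eq_0, Rle_antisym; [|apply Cmod_ge_0].
  apply (is_lim_seq_le (fun _ => Cmod (d y)) (fun n => rate z ^ n * K) (Cmod (d y)) 0).
  - intros n; apply Hn.
  - apply is_lim_seq_const.
  - replace (Finite 0) with (Rbar_mult 0 (Finite K)) by (simpl; f_equal; ring).
    apply is_lim_seq_mult'; [|apply is_lim_seq_const].
    apply is_lim_seq_geom; rewrite Rabs_pos_eq; [exact Hr|apply rate_pos].
Qed.

(** * The Neumann series and the power series of the inverse *)

Section Resolvent.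
Variable z : C.
Variable g : V G -> C.
Hypothesis Hz : Cmod z * alpha M < 1.
Hypothesis Hg : bounded_by 1 g.

Let Y (y : V G) : C := CSeries (fun n => oppow G (opf G z) n g y).
Let W (y : V G) : C := CSeries (fun n => Cpow z n * inv_coef G n g y)%C.
(** The terms of [W] moved up one place, so that [S_(n-1)] comes with [z^(n-1)] and no division by
    [z] occurs. *)
Let P (n : nat) (y : V G) : C :=
  match n with O => RtoC 0 | S k => (Cpow z k * inv_coef G k g y)%C end.

Lemma neumann_sum y : has_sum (fun n => oppow G (opf G z) n g y) (Y y).
Proof.
  apply (has_sum_dominated _ (fun n => rate z ^ n)).
  - intros n; now apply oppow_bounded.
  - apply ex_series_geom; rewrite Rabs_pos_eq; [now apply rate_lt_1|apply rate_pos].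
Qed.

Lemma inv_term_bound n y : Cmod (Cpow z n * inv_coef G n g y) <= (Cmod z * alpha M) ^ n.
Proof.
  rewrite Cmod_mult, Cmod_pow, Rpow_mult_distr.
  apply Rmult_le_compat_l; [apply pow_le, Cmod_ge_0|now apply inv_coef_bounded].
Qed.

Lemma inv_geom : 0 <= Cmod z * alpha M < 1.
Proof.
  destruct (alpha_facts M HM) as (A0 & _); split; [|exact Hz].
  apply Rmult_le_pos; [apply Cmod_ge_0|lra].
Qed.

Lemma inv_sum y : has_sum (fun n => Cpow z n * inv_coef G n g y)%C (W y).
Proof.
  apply (has_sum_dominated _ (fun n => (Cmod z * alpha M) ^ n)).
  - intros n; apply inv_term_bound.
  - apply ex_series_geom; rewrite Rabs_pos_eq; apply inv_geom.
Qed.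

Lemma shifted_inv_sum y : has_sum (fun n => P n y) (W y).
Proof.
  replace (W y) with (P 0 y + W y)%C by (simpl; ring).
  apply (has_sum_incr_1 (fun n => P n y)), inv_sum.
Qed.

Lemma inv_coef_pred_shift n y :
  (Cpow z n * opQ G (inv_coef_pred G n g) y)%C = (z * opQ G (P n) y)%C.
Proof. rewrite !opQ_val; destruct n; simpl; ring. Qed.

Lemma has_sum_opf (a : nat -> V G -> C) (S : V G -> C) x :
  (forall y, has_sum (fun n => a n y) (S y)) -> has_sum (fun n => opf G z (a n) x) (opf G z S x).
Proof.
  intros H; apply (has_sum_minus (fun n => z * opA G (a n) x)%C (fun n => z * z * opQ G (a n) x)%C);
    apply has_sum_scal; [now apply has_sum_opA|now apply has_sum_opQ].
Qed.

Lemma neumann_fixed y : Y y = (g y + opf G z Y y)%C.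
Proof.
  eapply has_sum_unique; [apply neumann_sum|].
  apply (has_sum_incr_1 (fun n => oppow G (opf G z) n g y)).
  exact (has_sum_opf (fun n => oppow G (opf G z) n g) Y y neumann_sum).
Qed.

(** The recursion for [S_(n+1)], multiplied by [z^(n+1)] and summed over [n]. *)
Lemma inv_fixed y : W y = (g y + opf G z W y)%C.
Proof.
  eapply has_sum_unique; [apply inv_sum|].
  replace (g y) with (Cpow z 0 * inv_coef G 0 g y)%C by (simpl; unfold opI; ring).
  apply (has_sum_incr_1 (fun n => Cpow z n * inv_coef G n g y)%C).
  apply (has_sum_ext (fun n => z * opA G (fun w => Cpow z n * inv_coef G n g w)%C y
                               - z * z * opQ G (P n) y)%C).
  - intros n; rewrite inv_coef_S, opA_scal, Cpow_S.
    replace (z * z * opQ G (P n) y)%C with (z * (z * opQ G (P n) y))%C by ring.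
    rewrite <- inv_coef_pred_shift; ring.
  - apply has_sum_minus; apply has_sum_scal;
      [apply has_sum_opA, inv_sum|apply has_sum_opQ, shifted_inv_sum].
Qed.

(** The difference of two bounded solutions of [h = g + f(z) h] is fixed by the contraction [f(z)].
    This avoids regrouping the expanded powers of [f(z)] by degree in [z]. *)
Lemma inverse_series y : Y y = W y.
Proof.
  set (d := fun y => (1 * Y y + (- RtoC 1) * W y)%C).
  assert (Hd : forall w, d w = RtoC 0).
  { apply (opf_fixed_zero z d
      (2 * Series (fun n => rate z ^ n) + 2 * Series (fun n => (Cmod z * alpha M) ^ n))).
    - now apply rate_lt_1.
    - intros w; unfold d; eapply Rle_trans; [apply Cmod_triangle|].
      rewrite !Cmod_mult, Cmod_opp, Cmod_1, !Rmult_1_l.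
      apply Rplus_le_compat; apply CSeries_bound.
      + intros n; now apply oppow_bounded.
      + apply ex_series_geom; rewrite Rabs_pos_eq; [now apply rate_lt_1|apply rate_pos].
      + intros n; apply inv_term_bound.
      + apply ex_series_geom; rewrite Rabs_pos_eq; apply inv_geom.
    - intros w; unfold d; rewrite opf_lin, (neumann_fixed w), (inv_fixed w) at 1; ring. }
  replace (Y y) with (d y + W y)%C by (unfold d; ring).
  rewrite Hd; ring.
Qed.

(** At a vertex [f'(z)] is a finite combination of values, so it passes through both expansions of
    the inverse term by term. *)
Lemma fB_series x : exists L,
  has_sum (fun n => opf' G z (oppow G (opf G z) n g) x) L /\
  has_sum (fun n => Cpow z n * fB_coef G n g x)%C L.
Proof.
  exists (opf' G z Y x); split.
  - apply (has_sum_minus (fun n => opA G (oppow G (opf G z) n g) x)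
             (fun n => 2 * z * opQ G (oppow G (opf G z) n g) x)%C).
    + exact (has_sum_opA (fun n => oppow G (opf G z) n g) Y x neumann_sum).
    + apply has_sum_scal.
      exact (has_sum_opQ (fun n => oppow G (opf G z) n g) Y x neumann_sum).
  - replace Y with W by (extensionality y; symmetry; apply inverse_series).
    apply (has_sum_ext (fun n => opA G (fun w => Cpow z n * inv_coef G n g w)%C x
                                 - 2 * z * opQ G (P n) x)%C).
    + intros n; rewrite opA_scal; unfold fB_coef.
      replace (2 * z * opQ G (P n) x)%C with (2 * (z * opQ G (P n) x))%C by ring.
      rewrite <- inv_coef_pred_shift; ring.
    + apply has_sum_minus; [apply has_sum_opA, inv_sum|].
      apply has_sum_scal, has_sum_opQ, shifted_inv_sum.
Qed.

End Resolvent.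
End Bounds.


(** * Integration along the segment from 0 to u *)

Lemma INR_S_neq_0 n : RtoC (INR (S n)) <> 0.
Proof. intros E; apply RtoC_inj in E; now apply (not_0_INR (S n)) in E. Qed.

Lemma Cmod_div_INR_le c n : Cmod (c / RtoC (INR (S n))) <= Cmod c.
Proof.
  rewrite Cmod_div by apply INR_S_neq_0.
  rewrite Cmod_R, Rabs_pos_eq by apply pos_INR.
  pose proof (pos_INR n); pose proof (Cmod_ge_0 c); rewrite S_INR.
  apply Rle_div_l; nra.
Qed.

Lemma Cmod_segment t u : 0 <= t <= 1 -> Cmod (RtoC t * u) <= Cmod u.
Proof.
  intros Ht; rewrite Cmod_mult, Cmod_R, Rabs_pos_eq by lra.
  pose proof (Cmod_ge_0 u); nra.
Qed.

(* No convergence of [a] is assumed: for [c = 0] the value of [CSeries a] is irrelevant. *)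
Lemma CSeries_scal_l c a l : has_sum (fun n => c * a n)%C l -> (c * CSeries a)%C = l.
Proof.
  intros H; destruct (Ceq_dec c 0) as [E|E].
  - subst c; rewrite Cmult_0_l; apply (has_sum_unique (fun _ => RtoC 0)); [apply has_sum_zero|].
    eapply has_sum_ext; [|exact H]; intros n; simpl; ring.
  - rewrite (has_sum_CSeries a (/ c * l)%C); [field; exact E|].
    eapply has_sum_ext; [|exact (has_sum_scal (/ c)%C _ _ H)]; intros n; simpl; field; exact E.
Qed.

Lemma Ccontinuous_inv p t : p t <> RtoC 0 -> Ccontinuous p t -> Ccontinuous (fun s => / p s)%C t.
Proof.
  intros Hp [H1 H2].
  assert (Hn : Re (p t) ^ 2 + Im (p t) ^ 2 <> 0).
  { rewrite <- Cmod2_alt; apply pow_nonzero.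
    intros E; apply Hp, Cmod_eq_0, E. }
  assert (Hc : continuous (fun s => / (Re (p s) ^ 2 + Im (p s) ^ 2)) t).
  { apply continuous_Rinv_comp; [|exact Hn].
    apply (continuous_plus (V := R_NormedModule)); simpl;
      repeat (apply (continuous_mult (K := R_AbsRing)); [assumption|]);
      apply continuous_const. }
  split; apply (continuous_mult (K := R_AbsRing)); trivial.
  apply (continuous_opp (V := R_NormedModule)), H2.
Qed.

Lemma Cderiv_opp F t l : Cderiv F t l -> Cderiv (fun s => - F s)%C t (- l)%C.
Proof.
  intros H; eapply Cderiv_eq.
  - apply (Cderiv_ext (fun s => (- RtoC 1) * F s)%C); [intros; ring|].
    apply Cderiv_scal, H.
  - simpl; ring.
Qed.

Lemma Clog_1 : Clog 1 = 0.
Proof.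
  unfold Clog, Carg; rewrite Cmod_1, ln_1; simpl.
  destruct (Rlt_dec 0 1); [|lra].
  replace (0 / 1) with 0 by field; now rewrite atan_0.
Qed.

(** Integrates [z + z^3 + ... = z / (1 - z^2)] along the segment, where [-(1/2) Clog (1 - z^2)] is a
    primitive. *)
Lemma even_log_series u : Cmod u < 1 ->
  has_sum (fun m => if Nat.even (S m) then Cpow u (S m) / RtoC (INR (S m)) else 0)%C
    (- (1 / 2) * Clog (1 - u * u))%C.
Proof.
  intros Hu.
  set (e := fun m t => if Nat.even (S m) then (u * Cpow (RtoC t * u) m)%C else RtoC 0).
  (* The whole segment maps into the right half plane, where the principal logarithm is
     differentiable. *)
  assert (Hsq : forall t, 0 <= t <= 1 -> 0 < Re (1 - RtoC t * u * (RtoC t * u))%C).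
  { intros t Ht; pose proof (Cmod_segment t u Ht) as H1.
    pose proof (Cmod_ge_0 (RtoC t * u)).
    pose proof (re_le_Cmod (RtoC t * u * (RtoC t * u))) as H2; rewrite Cmod_mult in H2.
    apply Rabs_le_between in H2.
    change (0 < 1 - Re (RtoC t * u * (RtoC t * u))); nra. }
  assert (Hnz : forall t, 0 <= t <= 1 -> (1 - RtoC t * u * (RtoC t * u))%C <> 0).
  { intros t Ht E; specialize (Hsq t Ht); rewrite E in Hsq; simpl in Hsq; lra. }
  destruct (has_int_series e (fun m => Cmod u ^ m)
      (fun m => if Nat.even (S m) then Cpow u (S m) / RtoC (INR (S m)) else 0)%C)
    as [L [HL1 HL2]].
  - intros m; unfold e; destruct (Nat.even (S m)).
    + set (F := fun t => (/ RtoC (INR (S m)) * Cpow (RtoC t * u) (S m))%C).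
      replace (Cpow u (S m) / RtoC (INR (S m)))%C with (F 1 - F 0)%C.
      * apply has_int_deriv; intros t Ht.
        -- eapply Cderiv_eq; [apply Cderiv_scal, Cderiv_line_pow|].
           simpl; field; apply INR_S_neq_0.
        -- apply Ccontinuous_mult; [apply Ccontinuous_const|].
           destruct m as [|m]; [apply Ccontinuous_const|].
           apply (Cderiv_continuous _ _ _ (Cderiv_line_pow u m t)).
      * unfold F; rewrite Cmult_1_l, Cmult_0_l, (Cpow_S 0); field; apply INR_S_neq_0.
    + replace (RtoC 0) with (RtoC 0 - RtoC 0)%C by ring.
      apply (has_int_deriv (fun _ => 0) (fun _ => RtoC 0 - RtoC 0)%C); intros t Ht;
        [eapply Cderiv_eq; [apply Cderiv_const|ring]|apply Ccontinuous_const].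
  - intros m t Ht; pose proof (Cmod_ge_0 u); unfold e.
    destruct (Nat.even (S m)); [|rewrite Cmod_0; now apply pow_le].
    rewrite Cmod_mult, Cmod_pow, <- (Rmult_1_l (Cmod u ^ m)).
    apply Rmult_le_compat; [lra|apply pow_le, Cmod_ge_0|lra|].
    apply pow_incr; split; [apply Cmod_ge_0|now apply Cmod_segment].
  - apply ex_series_geom; rewrite Rabs_pos_eq; [lra|apply Cmod_ge_0].
  - replace (- (1 / 2) * Clog (1 - u * u))%C with L; [exact HL1|].
    set (F := fun t => (- (1 / 2) * Clog (1 - RtoC t * u * (RtoC t * u)))%C).
    replace (- (1 / 2) * Clog (1 - u * u))%C with (F 1 - F 0)%C.
    2: { unfold F; rewrite Cmult_1_l, !Cmult_0_l.
         replace (1 - 0)%C with (RtoC 1) by ring; rewrite Clog_1; ring. }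
    eapply has_int_unique; [exact HL2|].
    apply (has_int_ext (fun t =>
      u * (RtoC t * u) * / (1 - RtoC t * u * (RtoC t * u)))%C).
    + intros t Ht; symmetry; apply has_sum_CSeries.
      set (z := (RtoC t * u)%C) in *.
      set (e1 := fun m => if Nat.even (S m) then Cpow z m else RtoC 0).
      assert (Hz : Cmod z < 1) by (pose proof (Cmod_segment t u Ht); unfold z; lra).
      assert (He : has_sum e1 (CSeries e1)).
      { apply (has_sum_dominated _ (fun m => Cmod z ^ m)).
        - intros m; unfold e1; destruct (Nat.even (S m)).
          + rewrite Cmod_pow; lra.
          + rewrite Cmod_0; apply pow_le, Cmod_ge_0.
        - apply ex_series_geom; rewrite Rabs_pos_eq; [lra|apply Cmod_ge_0]. }
      (* The first two terms are 0 and [z]; the remaining ones are [z^2] times the series itself. *)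
      assert (Hs : CSeries e1 = (z + z * z * CSeries e1)%C).
      { eapply has_sum_unique; [exact He|].
        replace (z + z * z * CSeries e1)%C with (e1 0%nat + (e1 1%nat + z * z * CSeries e1))%C
          by (unfold e1; simpl; ring).
        apply (has_sum_incr_1 e1), (has_sum_incr_1 (fun n => e1 (S n))).
        eapply has_sum_ext; [|exact (has_sum_scal (z * z)%C _ _ He)].
        intros n; unfold e1; change (Nat.even (S (S (S n)))) with (Nat.even (S n)).
        destruct (Nat.even (S n)); simpl; ring. }
      assert (Hv : CSeries e1 = (z * / (1 - z * z))%C).
      { specialize (Hnz t Ht); fold z in Hnz.
        transitivity ((CSeries e1 - z * z * CSeries e1) * / (1 - z * z))%C; [field; exact Hnz|].
        rewrite Hs at 1; field; exact Hnz. }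
      replace (u * z * / (1 - z * z))%C with (u * CSeries e1)%C by (rewrite Hv; ring).
      eapply has_sum_ext; [|exact (has_sum_scal u _ _ He)].
      intros n; unfold e, e1; fold z; destruct (Nat.even (S n)); [reflexivity|ring].
    + apply has_int_deriv; intros t Ht.
      * eapply Cderiv_eq.
        -- apply Cderiv_scal, Cderiv_Clog; [now apply Hsq|].
           apply Cderiv_plus; [apply Cderiv_const|].
           apply Cderiv_opp, Cderiv_mult; apply Cderiv_line.
        -- simpl; field; now apply Hnz.
      * apply Ccontinuous_mult.
        { apply Ccontinuous_mult; [apply Ccontinuous_const|apply Ccontinuous_line]. }
        apply Ccontinuous_inv; [now apply Hnz|].
        apply (Cderiv_continuous _ _ (0 + - (u * (RtoC t * u) + RtoC t * u * u))%C).
        apply Cderiv_plus; [apply Cderiv_const|].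
        apply Cderiv_opp, Cderiv_mult; apply Cderiv_line.
Qed.

(** * Powers of [f] along the segment and their derivatives *)

Section Segment.
Variable G : graph.
Variable u : C.
Variable g : V G -> C.

Lemma Cderiv_opA (F : R -> V G -> C) t (L : V G -> C) x :
  (forall y, Cderiv (fun s => F s y) t (L y)) ->
  Cderiv (fun s => opA G (F s) x) t (opA G L x).
Proof.
  intros H; unfold opA; induction (nbr G x) as [|y l IH]; simpl.
  - apply Cderiv_const.
  - now apply Cderiv_plus.
Qed.

Lemma Cderiv_opf (F : R -> V G -> C) t (L : V G -> C) x :
  (forall y, Cderiv (fun s => F s y) t (L y)) ->
  Cderiv (fun s => opf G (RtoC s * u) (F s) x) t
    (u * opf' G (RtoC t * u) (F t) x + opf G (RtoC t * u) L x)%C.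
Proof.
  intros H.
  assert (HQ : Cderiv (fun s => opQ G (F s) x) t (opQ G L x)).
  { rewrite opQ_val.
    apply (Cderiv_ext (fun s => (RtoC (INR (deg G x)) - 1) * F s x)%C);
      [intros; now rewrite opQ_val|apply Cderiv_scal, H]. }
  eapply Cderiv_eq.
  - apply Cderiv_plus.
    + apply Cderiv_mult; [apply Cderiv_line|apply Cderiv_opA, H].
    + apply Cderiv_opp, Cderiv_mult; [apply Cderiv_mult; apply Cderiv_line|exact HQ].
  - simpl; rewrite opf_val; unfold opf'; ring.
Qed.

Lemma Ccontinuous_opA (F : R -> V G -> C) t x :
  (forall y, Ccontinuous (fun s => F s y) t) -> Ccontinuous (fun s => opA G (F s) x) t.
Proof.
  intros H; unfold opA; induction (nbr G x) as [|y l IH]; simpl.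
  - apply Ccontinuous_const.
  - now apply Ccontinuous_plus.
Qed.

Lemma Ccontinuous_opp F t : Ccontinuous F t -> Ccontinuous (fun s => - F s)%C t.
Proof.
  intros H; apply (Ccontinuous_ext (fun s => (- RtoC 1) * F s)%C); [intros; ring|].
  apply Ccontinuous_mult; [apply Ccontinuous_const|exact H].
Qed.

Lemma Ccontinuous_opQ (F : R -> V G -> C) t x :
  (forall y, Ccontinuous (fun s => F s y) t) -> Ccontinuous (fun s => opQ G (F s) x) t.
Proof.
  intros H.
  apply (Ccontinuous_ext (fun s => (RtoC (INR (deg G x)) - 1) * F s x)%C).
  - intros s; now rewrite opQ_val.
  - apply Ccontinuous_mult; [apply Ccontinuous_const|apply H].
Qed.

Lemma Ccontinuous_opf (F : R -> V G -> C) t x :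
  (forall y, Ccontinuous (fun s => F s y) t) ->
  Ccontinuous (fun s => opf G (RtoC s * u) (F s) x) t.
Proof.
  intros H; apply Ccontinuous_plus; [|apply Ccontinuous_opp];
    apply Ccontinuous_mult.
  - apply Ccontinuous_line.
  - now apply Ccontinuous_opA.
  - apply Ccontinuous_mult; apply Ccontinuous_line.
  - now apply Ccontinuous_opQ.
Qed.

Lemma Ccontinuous_opf' (F : R -> V G -> C) t x :
  (forall y, Ccontinuous (fun s => F s y) t) ->
  Ccontinuous (fun s => opf' G (RtoC s * u) (F s) x) t.
Proof.
  intros H; apply Ccontinuous_plus; [|apply Ccontinuous_opp, Ccontinuous_mult;
    [apply Ccontinuous_mult|]].
  - now apply Ccontinuous_opA.
  - apply Ccontinuous_const.
  - apply Ccontinuous_line.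
  - now apply Ccontinuous_opQ.
Qed.

Lemma Ccontinuous_opAD (F : R -> V G -> C) t x :
  (forall y, Ccontinuous (fun s => F s y) t) -> Ccontinuous (fun s => opAD G (F s) x) t.
Proof.
  intros H; apply Ccontinuous_plus; [|apply Ccontinuous_opp].
  - apply (Ccontinuous_opA (fun s => opD G (F s))); intros y.
    apply Ccontinuous_mult; [apply Ccontinuous_const|apply H].
  - apply Ccontinuous_mult; [apply Ccontinuous_const|now apply Ccontinuous_opA].
Qed.

(* [comm_sum z n] is the sum of [j f(z)^(n-j) [A,D] f(z)^(j-1) g] over [1 <= j <= n]. *)
Fixpoint comm_sum (z : C) (n : nat) : V G -> C :=
  match n with
  | O => fun _ => RtoC 0
  | S n' => fun y => (opf G z (comm_sum z n') y
                      + RtoC (INR n) * opAD G (oppow G (opf G z) n' g) y)%C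
  end.

Lemma opf_Csum_nat z a b (F : nat -> V G -> C) x :
  opf G z (fun y => Csum_nat a b (fun j => F j y)) x =
  Csum_nat a b (fun j => opf G z (F j) x).
Proof.
  revert a; induction b as [|b IH]; intros a; simpl.
  - rewrite opf_val, opA_zero, opQ_val; ring.
  - transitivity (1 * opf G z (F a) x
                  + 1 * opf G z (fun y => Csum_nat (S a) b (fun j => F j y)) x)%C.
    + rewrite <- opf_lin; f_equal; extensionality y; ring.
    + rewrite IH; ring.
Qed.

Lemma Csum_nat_ext a b (F F' : nat -> C) :
  (forall j, (a <= j < a + b)%nat -> F j = F' j) -> Csum_nat a b F = Csum_nat a b F'.
Proof.
  revert a; induction b as [|b IH]; intros a H; [reflexivity|]; simpl.
  rewrite H by lia; f_equal; apply IH; intros; apply H; lia.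
Qed.

Lemma Csum_nat_Sr a b (F : nat -> C) :
  Csum_nat a (S b) F = (Csum_nat a b F + F (a + b)%nat)%C.
Proof.
  revert a; induction b as [|b IH]; intros a.
  - simpl; rewrite Nat.add_0_r; ring.
  - change (F a + Csum_nat (S a) (S b) F = F a + Csum_nat (S a) b F + F (a + S b)%nat)%C.
    rewrite IH; replace (S a + b)%nat with (a + S b)%nat by lia; ring.
Qed.

(** Going from [n] to [n + 1] puts one more [f(z)] on the left of every old summand and adds the
    summand [j = n + 1], which has no [f(z)] on its left. *)
Lemma comm_sum_val z n x :
  Csum_nat 1 n (fun j => RtoC (INR j) *
    opcomp G (oppow G (opf G z) (n - j)) (opcomp G (opAD G) (oppow G (opf G z) (j - 1))) g x)%C =
  comm_sum z n x.
Proof.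
  revert x; induction n as [|n IH]; intros x; [reflexivity|].
  rewrite Csum_nat_Sr.
  change (1 + n)%nat with (S n); replace (S n - S n)%nat with O by lia.
  replace (S n - 1)%nat with n by lia; simpl comm_sum.
  replace (comm_sum z n) with (fun x => Csum_nat 1 n (fun j => RtoC (INR j) *
    opcomp G (oppow G (opf G z) (n - j)) (opcomp G (opAD G) (oppow G (opf G z) (j - 1))) g x)%C)
    by (extensionality y; apply IH).
  rewrite opf_Csum_nat; f_equal.
  apply Csum_nat_ext; intros j Hj.
  replace (S n - j)%nat with (S (n - j)) by lia; unfold opcomp; simpl; unfold opcomp at 1.
  set (h := oppow G (opf G z) (n - j) _).
  transitivity (RtoC (INR j) * opf G z h x + 0 * opf G z h x)%C; [ring|].
  rewrite <- opf_lin; f_equal; extensionality y; ring.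
Qed.

(* [u * pow_deriv z n] is the derivative in [t] of [f(z)^(n+1) g] at [z = t u]. *)
Definition pow_deriv (z : C) (n : nat) (y : V G) : C :=
  (RtoC (INR (S n)) * opf' G z (oppow G (opf G z) n g) y - z * z * comm_sum z n y)%C.

(** The product rule for [f f^(n+1)]. Moving [f] past [f'] in the [n + 1] copies of [f' f^n] costs
    [(n+1) z^2 [A,D] f^n], which is the source of the weight [j] in the commutator sum. *)
Lemma pow_deriv_S z n y :
  pow_deriv z (S n) y =
  (opf' G z (oppow G (opf G z) (S n) g) y + opf G z (pow_deriv z n) y)%C.
Proof.
  unfold pow_deriv at 2.
  set (c := RtoC (INR (S n))).
  replace (fun y => (c * opf' G z (oppow G (opf G z) n g) y - z * z * comm_sum z n y)%C)
    with (fun y => (c * opf' G z (oppow G (opf G z) n g) y + (- (z * z)) * comm_sum z n y)%C)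
    by (extensionality w; ring).
  rewrite opf_lin, opf_opf'; unfold pow_deriv.
  rewrite (S_INR (S n)), RtoC_plus; fold c.
  change (comm_sum z (S n) y) with
    (opf G z (comm_sum z n) y + c * opAD G (oppow G (opf G z) n g) y)%C.
  change (opf G z (oppow G (opf G z) n g)) with (oppow G (opf G z) (S n) g); ring.
Qed.

Lemma Cderiv_oppow n t y :
  Cderiv (fun s => oppow G (opf G (RtoC s * u)) (S n) g y) t (u * pow_deriv (RtoC t * u) n y)%C.
Proof.
  revert y; induction n as [|n IH]; intros y.
  - eapply Cderiv_eq; [exact (Cderiv_opf (fun _ => g) t (fun _ => RtoC 0) y
      (fun w => Cderiv_const (g w) t))|].
    rewrite opf_val, opA_zero, opQ_val; unfold pow_deriv; simpl; unfold opI; ring.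
  - eapply Cderiv_eq; [exact (Cderiv_opf (fun s => oppow G (opf G (RtoC s * u)) (S n) g) t _ y IH)|].
    rewrite pow_deriv_S.
    set (p := pow_deriv (RtoC t * u) n); simpl.
    replace (opf G (RtoC t * u) (fun w => u * p w)%C y) with (u * opf G (RtoC t * u) p y)%C; [ring|].
    transitivity (u * opf G (RtoC t * u) p y + 0 * opf G (RtoC t * u) p y)%C; [ring|].
    rewrite <- opf_lin; f_equal; extensionality w; ring.
Qed.

Lemma Ccontinuous_oppow n t y : Ccontinuous (fun s => oppow G (opf G (RtoC s * u)) n g y) t.
Proof.
  destruct n as [|n]; [apply Ccontinuous_const|].
  apply (Cderiv_continuous _ _ _ (Cderiv_oppow n t y)).
Qed.

Lemma Ccontinuous_comm_sum n t y : Ccontinuous (fun s => comm_sum (RtoC s * u) n y) t.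
Proof.
  revert y; induction n as [|n IH]; intros y; simpl; [apply Ccontinuous_const|].
  apply Ccontinuous_plus; [now apply Ccontinuous_opf|].
  apply Ccontinuous_mult; [apply Ccontinuous_const|].
  apply Ccontinuous_opAD; intros w; apply Ccontinuous_oppow.
Qed.

Lemma Ccontinuous_pow_deriv n t y : Ccontinuous (fun s => pow_deriv (RtoC s * u) n y) t.
Proof.
  apply Ccontinuous_plus; [|apply Ccontinuous_opp]; apply Ccontinuous_mult.
  - apply Ccontinuous_const.
  - apply Ccontinuous_opf'; intros w; apply Ccontinuous_oppow.
  - apply Ccontinuous_mult; apply Ccontinuous_line.
  - apply Ccontinuous_comm_sum.
Qed.

Lemma oppow_0 n y : oppow G (opf G 0) (S n) g y = RtoC 0.
Proof. simpl; unfold opcomp; rewrite opf_val; ring. Qed.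

Variable M : nat.
Hypothesis Hsimple : simple_graph G.
Hypothesis Hdeg : forall x, (deg G x <= M)%nat.
Hypothesis HM : (1 <= M)%nat.
Hypothesis Hu : Cmod u * alpha M < 1.
Hypothesis Hg : bounded_by G 1 g.

Lemma segment_rate t : 0 <= t <= 1 ->
  Cmod (RtoC t * u) * alpha M < 1 /\ rate M (RtoC t * u) <= rate M u.
Proof.
  intros Ht; pose proof (Cmod_segment t u Ht); destruct (alpha_facts M HM) as (A0 & _).
  split; [nra|now apply rate_mono].
Qed.

Let F := INR M + 2 * Cmod u * INR M.

Lemma F_pos : 0 <= F.
Proof. unfold F; pose proof (pos_INR M); pose proof (Cmod_ge_0 u); nra. Qed.

Lemma opf'_oppow_bound n t y : 0 <= t <= 1 ->
  Cmod (opf' G (RtoC t * u) (oppow G (opf G (RtoC t * u)) n g) y) <= F * rate M u ^ n.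
Proof.
  intros Ht; destruct (segment_rate t Ht) as [H1 H2].
  eapply Rle_trans; [apply (opf'_bounded G M Hdeg HM), (oppow_bounded G M Hdeg HM), Hg|].
  pose proof (rate_pos M (RtoC t * u)); pose proof (pos_INR M).
  pose proof (Cmod_segment t u Ht); pose proof (Cmod_ge_0 (RtoC t * u)).
  apply Rmult_le_compat; [nra|now apply pow_le|unfold F; nra|now apply pow_incr].
Qed.

(** Induction along the product rule, without estimating [comm_sum]; the factor [n + 1] is cancelled
    by the [1/(n+1)] of the logarithm. *)
Lemma pow_deriv_bound n t y : 0 <= t <= 1 ->
  Cmod (pow_deriv (RtoC t * u) n y) <= INR (S n) * (F * rate M u ^ n).
Proof.
  intros Ht; revert y; induction n as [|n IH]; intros y.
  - pose proof (opf'_oppow_bound 0 t y Ht) as H.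
    replace (pow_deriv (RtoC t * u) 0 y)
      with (opf' G (RtoC t * u) (oppow G (opf G (RtoC t * u)) 0 g) y)
      by (unfold pow_deriv; simpl; ring).
    simpl INR; lra.
  - rewrite pow_deriv_S; eapply Rle_trans; [apply Cmod_triangle|].
    pose proof (opf'_oppow_bound (S n) t y Ht) as H1.
    pose proof (opf_bounded G M Hdeg HM (RtoC t * u) _ _ IH y) as H2.
    destruct (segment_rate t Ht) as [_ H3].
    assert (H4 : 0 <= INR (S n) * (F * rate M u ^ n)).
    { apply Rmult_le_pos; [apply pos_INR|apply Rmult_le_pos; [apply F_pos|apply pow_le, rate_pos]]. }
    assert (H5 : rate M (RtoC t * u) * (INR (S n) * (F * rate M u ^ n))
                 <= rate M u * (INR (S n) * (F * rate M u ^ n)))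
      by now apply Rmult_le_compat_r.
    rewrite (S_INR (S n)).
    replace ((INR (S n) + 1) * (F * rate M u ^ S n))
      with (F * rate M u ^ S n + rate M u * (INR (S n) * (F * rate M u ^ n))) by (simpl pow; ring).
    lra.
Qed.

(* Integrating termwise the identity
   [f' f^n = (1/(n+1)) (f^(n+1))' + (z^2/(n+1)) comm_sum n]. *)
Lemma fB_log_series x : exists L J,
  has_sum (fun n => oppow G (opf G u) (S n) g x / RtoC (INR (S n)))%C L /\
  has_int (fun t => RtoC t * u * (RtoC t * u) *
    CSeries (fun n => / RtoC (INR (S n)) * comm_sum (RtoC t * u) n x) * u)%C J /\
  has_sum (fun n => fB_coef G n g x / RtoC (INR (S n)) * Cpow u (S n))%C (J + L)%C.
Proof.
  pose proof (Cmod_ge_0 u) as Hu0.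
  destruct (alpha_facts M HM) as (A0 & A1 & _).
  assert (Hr : 0 <= rate M u < 1) by (split; [apply rate_pos|now apply rate_lt_1]).
  assert (HL : has_sum (fun n => oppow G (opf G u) (S n) g x / RtoC (INR (S n)))%C
    (CSeries (fun n => oppow G (opf G u) (S n) g x / RtoC (INR (S n)))%C)).
  { apply (has_sum_dominated _ (fun n => rate M u * rate M u ^ n)).
    - intros n; eapply Rle_trans; [apply Cmod_div_INR_le|].
      apply (oppow_bounded G M Hdeg HM u (S n)), Hg.
    - now apply ex_series_scal_geom. }
  set (L := CSeries _) in HL.
  (* [h n] is [u f' f^n g] and [d n] is the [t]-derivative of [f^(n+1) g / (n+1)], both at [x];
     their difference is the commutator term. *)
  set (h := fun n t => (u * opf' G (RtoC t * u) (oppow G (opf G (RtoC t * u)) n g) x)%C).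
  set (d := fun n t => (/ RtoC (INR (S n)) * (u * pow_deriv (RtoC t * u) n x))%C).
  set (c := Cmod u * F).
  assert (Hc : 0 <= c) by (apply Rmult_le_pos; [exact Hu0|apply F_pos]).
  assert (Hh : forall n t, 0 <= t <= 1 -> Cmod (h n t) <= c * rate M u ^ n).
  { intros n t Ht; unfold h, c; rewrite Cmod_mult, Rmult_assoc.
    apply Rmult_le_compat_l; [exact Hu0|now apply opf'_oppow_bound]. }
  assert (Hd : forall n t, 0 <= t <= 1 -> Cmod (d n t) <= c * rate M u ^ n).
  { intros n t Ht; unfold d, c; rewrite !Cmod_mult, Cmod_inv by apply INR_S_neq_0.
    rewrite Cmod_R, (Rabs_pos_eq _ (pos_INR _)).
    pose proof (pow_deriv_bound n t x Ht) as H1.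
    assert (H2 : 0 < INR (S n)) by (apply lt_0_INR; lia).
    apply (Rmult_le_reg_l (INR (S n))); [exact H2|].
    rewrite <- Rmult_assoc, Rinv_r, Rmult_1_l by lra.
    replace (INR (S n) * (Cmod u * F * rate M u ^ n))
      with (Cmod u * (INR (S n) * (F * rate M u ^ n))) by ring.
    now apply Rmult_le_compat_l. }
  assert (HdI : forall n, has_int (d n) (oppow G (opf G u) (S n) g x / RtoC (INR (S n)))%C).
  { intros n.
    set (P := fun t => (/ RtoC (INR (S n)) * oppow G (opf G (RtoC t * u)) (S n) g x)%C).
    replace (oppow G (opf G u) (S n) g x / RtoC (INR (S n)))%C with (P 1 - P 0)%C.
    - apply has_int_deriv; intros t Ht.
      + apply Cderiv_scal, Cderiv_oppow.
      + apply Ccontinuous_mult; [apply Ccontinuous_const|].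
        apply Ccontinuous_mult; [apply Ccontinuous_const|apply Ccontinuous_pow_deriv].
    - unfold P; rewrite Cmult_1_l, Cmult_0_l, oppow_0; field; apply INR_S_neq_0. }
  (* The integrals of [h] are only named: their sum [Hs] links the logarithm, the commutator
     integral and the power series, and then drops out. *)
  assert (HhI : exists H : nat -> C, forall n, has_int (h n) (H n)).
  { exists (fun n => RInt (V := C_R_CompleteNormedModule) (h n) 0 1); intros n.
    destruct (has_int_continuous (h n)) as [l Hl].
    - intros t Ht; apply Ccontinuous_mult; [apply Ccontinuous_const|].
      apply Ccontinuous_opf'; intros y; apply Ccontinuous_oppow.
    - now rewrite (has_int_RInt _ _ Hl). }
  destruct HhI as [H HhI].
  destruct (has_int_series h _ H HhI Hh (ex_series_scal_geom c _ Hr)) as [Hs [Hs1 Hs2]].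
  destruct (has_int_series (fun n t => h n t - d n t)%C (fun n => 2 * c * rate M u ^ n)
    (fun n => H n - oppow G (opf G u) (S n) g x / RtoC (INR (S n)))%C) as [J [J1 J2]].
  { intros n; now apply has_int_minus. }
  { intros n t Ht; eapply Rle_trans; [apply Cmod_minus_le|].
    specialize (Hh n t Ht); specialize (Hd n t Ht); lra. }
  { now apply ex_series_scal_geom. }
  assert (EJ : J = (Hs - L)%C).
  { eapply has_sum_unique; [exact J1|now apply has_sum_minus]. }
  (* The same function of [t] as the sum of [h], now expanded in powers of [z], whose termwise
     integrals are explicit. *)
  set (k := fun n t => (u * (Cpow (RtoC t * u) n * fB_coef G n g x))%C).
  destruct (has_int_series k (fun n => Cmod u * (3 * INR M) * (Cmod u * alpha M) ^ n)
    (fun n => fB_coef G n g x / RtoC (INR (S n)) * Cpow u (S n))%C) as [K [K1 K2]].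
  { intros n.
    set (P := fun t => (fB_coef G n g x / RtoC (INR (S n)) * Cpow (RtoC t * u) (S n))%C).
    replace (fB_coef G n g x / RtoC (INR (S n)) * Cpow u (S n))%C with (P 1 - P 0)%C.
    - apply has_int_deriv; intros t Ht.
      + eapply Cderiv_eq; [apply Cderiv_scal, Cderiv_line_pow|].
        unfold k; field; apply INR_S_neq_0.
      + apply Ccontinuous_mult; [apply Ccontinuous_const|].
        apply Ccontinuous_mult; [|apply Ccontinuous_const].
        destruct n as [|n]; [apply Ccontinuous_const|].
        apply (Cderiv_continuous _ _ _ (Cderiv_line_pow u n t)).
    - unfold P; rewrite Cmult_1_l, Cmult_0_l, (Cpow_S 0); field; apply INR_S_neq_0. }
  { intros n t Ht; unfold k; pose proof (Cmod_segment t u Ht) as Hz.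
    set (z := (RtoC t * u)%C) in *; rewrite !Cmod_mult, Cmod_pow, Rpow_mult_distr, !Rmult_assoc.
    apply Rmult_le_compat_l; [exact Hu0|].
    apply Rle_trans with (Cmod u ^ n * (3 * INR M * alpha M ^ n)); [|right; ring].
    apply Rmult_le_compat; [apply pow_le, Cmod_ge_0|apply Cmod_ge_0| |].
    - apply pow_incr; split; [apply Cmod_ge_0|exact Hz].
    - now apply fB_coef_bounded. }
  { apply ex_series_scal_geom; split; [apply Rmult_le_pos; lra|exact Hu]. }
  assert (EK : K = Hs).
  { eapply has_int_unique; [exact K2|].
    eapply has_int_ext; [|exact Hs2]; intros t Ht.
    destruct (segment_rate t Ht) as [Hz _].
    destruct (fB_series G M Hdeg HM (RtoC t * u) g Hz Hg x) as [l [l1 l2]].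
    transitivity (u * l)%C; [|symmetry]; apply has_sum_CSeries, has_sum_scal; assumption. }
  exists L, J; split; [exact HL|split].
  - eapply has_int_ext; [|exact J2]; intros t Ht; symmetry.
    set (z := (RtoC t * u)%C).
    transitivity (z * z * u * CSeries (fun n => / RtoC (INR (S n)) * comm_sum z n x))%C; [ring|].
    apply CSeries_scal_l.
    apply (has_sum_ext (fun n => h n t - d n t)%C).
    + intros n; unfold h, d, pow_deriv; fold z; field; apply INR_S_neq_0.
    + apply (has_sum_dominated _ (fun n => 2 * c * rate M u ^ n)).
      * intros n; eapply Rle_trans; [apply Cmod_minus_le|].
        specialize (Hh n t Ht); specialize (Hd n t Ht); lra.
      * now apply ex_series_scal_geom.
  - replace (J + L)%C with K by (rewrite EK, EJ; ring); exact K1.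
Qed.

End Segment.


(** * Comparison of the exponents *)

Theorem theorem4p4 (G : graph) (M : nat)
  (Hsimple : simple_graph G) (Hcount : countable_vertices G)
  (Hconn : connected G) (Hbdd : bounded_degree G)
  (Hdeg1 : no_degree_one G) (HM : is_sup_degree G M)
  (x0 x : V G) (u : C) (Hu : Cmod u < / alpha M) :
  Cex_series (Zseries G u x0 x) /\
  Cex_series (log_I_minus_series G (g_log G u) x0 x) /\
  Cex_series (Rseries G u x0 x) /\
  ZX G u x0 x =
    (Cpowc (RtoC 1 - u * u)
       (RtoC (- ((INR (deg G x0) - 2) / 2)) * delta G x0 x) *
     Cexp (- log_I_minus_entry G (g_log G u) x0 x) *
     Cexp (Cint_0 (integrand G x0 x) u) *
     Cexp (CSeries (Rseries G u x0 x)))%C.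
Proof.
  destruct HM as [Hdeg [y Hy]].
  pose proof (Cmod_ge_0 u) as Hu0.
  (* [M] is attained, so [M = 1] would give a vertex of degree one. From [M >= 2] follow
     [alpha >= 2], hence [|u| < 1] for the logarithm of [1 - u^2], and the bound on [R_m]. *)
  assert (HM2 : (2 <= M)%nat).
  { destruct M as [|[|m]]; [|now elim (Hdeg1 y)|lia].
    (* [alpha 0 = 0] and [/ 0 = 0], so no [u] is admissible *)
    exfalso; unfold alpha in Hu; simpl in Hu.
    replace ((0 + sqrt (0 * (0 * 1) + 4 * 0)) / 2) with 0 in Hu; [rewrite Rinv_0 in Hu; lra|].
    replace (0 * (0 * 1) + 4 * 0) with 0 by ring; rewrite sqrt_0; field. }
  assert (HM1 : (1 <= M)%nat) by lia.
  destruct (alpha_facts M HM1) as (A0 & A1 & _).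
  assert (HM2' : 2 <= INR M) by (apply (le_INR 2); exact HM2).
  assert (Hua : Cmod u * alpha M < 1).
  { apply (Rmult_lt_compat_r (alpha M)) in Hu; [|exact A0].
    now rewrite Rinv_l in Hu by lra. }
  assert (Hu1 : Cmod u < 1) by nra.
  pose proof (delta_bounded G x0) as Hd.
  destruct (fB_log_series G u (delta G x0) M Hdeg HM1 Hua Hd x)
    as (L & J & HL & HJ & HB).
  assert (HR : has_sum (Rseries G u x0 x) (CSeries (Rseries G u x0 x))).
  { set (q := Cmod u * alpha M).
    assert (Hq : 0 <= q < 1) by (split; [apply Rmult_le_pos; lra|exact Hua]).
    apply (has_sum_dominated _ (fun k => 4 * q ^ 3 * q ^ k)); [|now apply ex_series_scal_geom].
    intros k; unfold Rseries; set (m := (k + 3)%nat).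
    assert (Hm : 0 < INR m) by (apply lt_0_INR; unfold m; lia).
    pose proof (opR_bounded G M Hsimple Hdeg HM1 m _ HM2 Hd x) as H1.
    rewrite Cmod_mult, Cmod_div, Cmod_pow, Cmod_R, Rabs_pos_eq by
      (try lra; intros E; apply RtoC_inj in E; lra).
    replace (4 * q ^ 3 * q ^ k) with (4 * alpha M ^ m * Cmod u ^ m)
      by (unfold q, m; rewrite !Rpow_mult_distr, !pow_add; ring).
    apply Rmult_le_compat_r; [now apply pow_le|].
    apply Rle_div_l; [exact Hm|]; unfold entry; lra. }
  set (RS := CSeries (Rseries G u x0 x)) in *.
  (* [Rseries] starts at length 3 and [Zseries] at length 1; the two added terms vanish because
     [R_1 = R_2 = 0]. *)
  assert (HR' : has_sum
    (fun k => entry G (opR G (S k)) x0 x / RtoC (INR (S k)) * Cpow u (S k))%C RS).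
  { set (a := fun k => (entry G (opR G (S k)) x0 x / RtoC (INR (S k)) * Cpow u (S k))%C).
    replace RS with (a 0%nat + (a 1%nat + RS))%C.
    - apply (has_sum_incr_1 a), (has_sum_incr_1 (fun n => a (S n))).
      eapply has_sum_ext; [|exact HR]; intros n; unfold Rseries, a.
      now replace (n + 3)%nat with (S (S (S n))) by lia.
    - unfold a, entry, opR; simpl; unfold Cdiv; ring. }
  set (s := (RtoC (INR (deg G x0) - 2) * delta G x0 x)%C).
  assert (HZ : has_sum (Zseries G u x0 x)
    (J + L + s * (- (1 / 2) * Clog (1 - u * u)) + RS)%C).
  { eapply has_sum_ext; [|exact (has_sum_plus _ _ _ _
      (has_sum_plus _ _ _ _ HB (has_sum_scal s _ _ (even_log_series u Hu1))) HR')].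
    intros k; unfold Zseries, entry; cbv beta; rewrite (opN_S G Hsimple).
    (* The even terms carry [deg x] and the statement [deg x0]; [delta] vanishes unless the two
       vertices coincide. *)
    replace (RtoC (INR (deg G x) - 2) * delta G x0 x)%C with s.
    - destruct (Nat.even (S k)); field; apply INR_S_neq_0.
    - unfold s, delta; destruct (V_eq_dec G x x0) as [E|E]; [now rewrite E|ring]. }
  rewrite g_log_opf.
  split; [exact (has_sum_Cex _ _ HZ)|split; [exact (has_sum_Cex _ _ HL)|
    split; [exact (has_sum_Cex _ _ HR)|]]].
  (* Every factor, the complex power included, is a value of [Cexp], so it suffices to compare
     exponents. *)
  unfold ZX, Cpowc; rewrite (has_sum_CSeries _ _ HZ), <- !Cexp_plus; f_equal.
  replace (log_I_minus_entry G (opf G u) x0 x) with (- L)%C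
    by (unfold log_I_minus_entry; f_equal; symmetry; exact (has_sum_CSeries _ _ HL)).
  replace (Cint_0 (integrand G x0 x) u) with J.
  - unfold s; rewrite RtoC_opp, RtoC_div by lra; field.
  - symmetry; unfold Cint_0; apply has_int_RInt.
    eapply has_int_ext; [|exact HJ]; intros t Ht; cbv beta.
    unfold integrand; do 3 f_equal; extensionality k.
    rewrite <- (comm_sum_val G (delta G x0) _ k x).
    replace (S k - 1)%nat with k by lia; reflexivity.
Qed.
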